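(* Suppose that $0<a_k<\infty$ and $0<b_k<\infty$ for all $k\in\mathbb{N}$, that $\sup_{k\in\mathbb{N}}a_k<\infty$ and $\sup_{k\in\mathbb{N}}b_k<\infty$, that $\mathcal{V}\ne\emptyset$, that $\sum_{k\in\mathbb{Z}_+}\alpha_k=\infty$, and that $X(0)\in\mathbb{X}_{\mathrm F}$. Then $X_1(t)\to-\infty$ in probability as $t\to\infty$.
   Context: $\mathbb{N}=\{1,2,\dots\}$, $\mathbb{Z}_+=\{0,1,2,\dots\}$. Particle system: $\mathbb{X}=\{(x_1,x_2,\dots)\in\mathbb{Z}^{\mathbb{N}}:x_1<x_2<\cdots\}$ and $\mathbb{X}_{\mathrm F}=\{x\in\mathbb{X}:x_{k+1}-x_k=1\text{ for all but finitely many }k\}$. $X(t)=(X_1(t),X_2(t),\dots)$ is the continuous-time Markov chain in which the $k$th particle from the left, at location $X_k(t)$, attempts to jump one step left at rate $a_k$ and one step right at rate $b_k$, an attempted jump being suppressed if the destination site is occupied. For $X(0)\in\mathbb{X}_{\mathrm F}$ and bounded rates, this is a well-defined non-explosive Markov chain on the countable set $\mathbb{X}_{\mathrm F}$. Definitions: $\alpha_0=1$, $\beta_0=0$, and for $k\in\mathbb{N}$, $\alpha_k=\frac{a_1\cdots a_k}{b_1\cdots b_k}$, $\beta_k=\frac1{b_k}+\frac{a_k}{b_kb_{k-1}}+\cdots+\frac{a_k\cdots a_2}{b_k\cdots b_1}$. $\mathcal{V}$ is the set of $v\in\mathbb{R}$ such that $\alpha_k+v\beta_k\in(0,1)$ for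 all $k\in\mathbb{N}$. ''$X_1(t)\to-\infty$ in probability'' means $\mathbb{P}[X_1(t)<-M]\to1$ as $t\to\infty$ for every $M\in\mathbb{R}_+$. *)

(* Defs.v *)
From HB Require Import structures.
From mathcomp Require Import all_boot all_order all_algebra.
From mathcomp Require Import all_classical all_reals all_analysis.

Set Implicit Arguments.
Unset Strict Implicit.
Unset Printing Implicit Defensive.

Import Order.TTheory GRing.Theory Num.Theory.
Import numFieldNormedType.Exports.

Local Open Scope classical_set_scope.
Local Open Scope ring_scope.

(* Continuous-time Markov chains on a subset S of T that is meant to be
   countable and carries the discrete topology; Q is the matrix of transition
   rates, with Q x x equal to minus the total rate of leaving x.  Only times
   t >= 0 are relevant. *)
Section MarkovChain.
Context {R : realType} {T : choiceType}.

Record transition_function (S : set T) (p : R -> T -> T -> R) : Prop := {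
  tf_ge0 : forall (t : R) x y, 0 <= t -> S x -> S y -> 0 <= p t x y ;
  tf_sum1 : forall (t : R) x, 0 <= t -> S x ->
    (\esum_(y in S) (p t x y)%:E = 1)%E ;
  tf_time0 : forall x y, S x -> S y -> p 0 x y = (x == y)%:R ;
  tf_chapman_kolmogorov : forall (s t : R) x y, 0 <= s -> 0 <= t -> S x -> S y ->
    ((p (s + t) x y)%:E = \esum_(z in S) (p s x z * p t z y)%:E)%E }.

Definition has_rates (S : set T) (Q : T -> T -> R) (p : R -> T -> T -> R)
  : Prop :=
  forall x y, S x -> S y ->
    (p h x y - (x == y)%:R) / h @[h --> 0^'+] --> Q x y.

(* The last field is the Markov property: given X s = x, the state at time
   s + t has law p t x, whatever the states r i |-> z i observed before s. *)
Record markov_process (S : set T) (p : R -> T -> T -> R)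
    d (Omega : measurableType d) (P : probability Omega R)
    (X : R -> Omega -> T) : Prop := {
  mp_state : forall (t : R) w, 0 <= t -> S (X t w) ;
  mp_measurable : forall (t : R) x, 0 <= t -> S x ->
    measurable [set w | X t w = x] ;
  mp_right_continuous : forall (t : R) w, 0 <= t ->
    \forall s \near t^'+, X s w = X t w ;
  mp_markov : forall (n : nat) (r : 'I_n -> R) (z : 'I_n -> T)
      (s t : R) x y,
    (forall i, 0 <= r i <= s) -> 0 <= t -> 0 <= s -> S x -> S y ->
    P [set w | [/\ forall i, X (r i) w = z i, X s w = x
                 & X (s + t) w = y]] =
    (P [set w | (forall i, X (r i) w = z i) /\ X s w = x]
       * (p t x y)%:E)%E }.

Definition markov_chain (S : set T) (Q : T -> T -> R)
    d (Omega : measurableType d) (P : probability Omega R)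
    (X : R -> Omega -> T) : Prop :=
  exists p, [/\ transition_function S p, has_rates S Q p
              & markov_process S p P X].

End MarkovChain.

(* Particles, and the rates a and b, are indexed from 0: the index k : nat
   stands for the (k+1)-st particle from the left. *)
Section ExclusionProcess.
Context {R : realType}.
Implicit Types (a b : nat -> R) (x y : nat -> int).

Definition configuration : set (nat -> int) :=
  [set x | forall k, x k < x k.+1].

Definition finite_configuration : set (nat -> int) :=
  [set x | configuration x /\ finite_set [set k | x k.+1 - x k != 1]].

Definition vacant x (site : int) : Prop := forall j, x j != site.

Definition hop x (k : nat) (e : int) : nat -> int :=
  fun j => if j == k then x k + e else x j.

(* The sums over k below have finite support when x is a finite
   configuration, since then only finitely many particles can move. *)
Definition jump_rate a b x y : R :=
  \sum_(k \in [set: nat])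
     (a k * `[< vacant x (x k - 1) /\ y = hop x k (-1) >]%:R
      + b k * `[< vacant x (x k + 1) /\ y = hop x k 1 >]%:R).

Definition exit_rate a b x : R :=
  \sum_(k \in [set: nat])
     (a k * `[< vacant x (x k - 1) >]%:R
      + b k * `[< vacant x (x k + 1) >]%:R).

Definition exclusion_rates a b x y : R :=
  if x == y then - exit_rate a b x else jump_rate a b x y.

Definition exclusion_process a b
    d (Omega : measurableType d) (P : probability Omega R)
    (X : R -> Omega -> nat -> int) : Prop :=
  markov_chain finite_configuration (exclusion_rates a b) P X.

(* With a_{i+1} = a i and b_{i+1} = b i these are
     alpha_k = (a_1 ... a_k) / (b_1 ... b_k),
     beta_k = sum_{1 <= j <= k} (a_{j+1} ... a_k) / (b_j ... b_k). *)
Definition alpha a b (k : nat) : R :=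
  (\prod_(0 <= i < k) a i) / (\prod_(0 <= i < k) b i).

Definition beta a b (k : nat) : R :=
  \sum_(0 <= j < k) (\prod_(j.+1 <= i < k) a i) / (\prod_(j <= i < k) b i).

Definition admissible a b : set R :=
  [set v | forall k, (0 < k)%N -> 0 < alpha a b k + v * beta a b k < 1].

End ExclusionProcess.

(* Main.v *)
Require Import Defs.
From HB Require Import structures.
From mathcomp Require Import all_boot all_order all_algebra.
From mathcomp Require Import all_classical all_reals all_analysis.
From mathcomp Require Import zify ring lra.
Set Implicit Arguments.
Unset Strict Implicit.
Unset Printing Implicit Defensive.
Import Order.TTheory GRing.Theory Num.Theory.
Import numFieldNormedType.Exports.
Local Open Scope classical_set_scope.
Local Open Scope ring_scope.

(** Read a configuration x whose particles eventually sit at x_k = c + k as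
    x_k = c + k - y_k.  Then y is nonincreasing with finite support, i.e. a
    Young diagram with rows y_0 >= y_1 >= ..., and the exclusion process is a
    growth process: a left jump of particle k adds a cell to row k at rate a_k,
    a right jump removes one at rate b_k, and the exclusion rule suppresses
    exactly the moves that would leave the set of diagrams.  The claim becomes
    that the first row y_0 tends to infinity in probability.

    Confine the diagram to N rows and m+1 columns, suppressing every growth
    outside this box.  The attempted moves are order-preserving maps
    ([step_mono]), so the confined process lies below the true one
    ([box_kernel_generator_le]), and it is enough to make the confined first
    row exceed m with probability close to 1 in the long run.  The confined
    process is a finite irreducible chain, reversible for the weight
    prod_k (a_k/b_k)^(y_k) ([box_kernel_stationary]).  Let Z(h) be the total
    weight of the diagrams with at most N rows and h columns; the stationary
    probability that the first row does not exceed m is Z(m)/Z(m+1).  Inserting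
    a column of height k multiplies the weight of a diagram by alpha_k, and a
    diagram with at most m+1 columns has at most m+1 distinct column heights,
    whence (alpha_1 + ... + alpha_N) Z(m) <= (m+1) Z(m+1)
    ([box_mass_column]).  As the series of the alpha_k diverges, Z(m)/Z(m+1)
    tends to 0 when N grows.

    The comparison with the true process is made on the function v_t(x), the
    probability of being in the target set at time t after starting at x.  The
    Chapman-Kolmogorov equation and the rates show that v_(t+h) is at least
    v_t + h (L v_t - eps) for small h, uniformly in t ([mass_backward]).  A
    minimum principle for such differential inequalities on a countable state
    space ([minimum_principle]) then bounds v_t below by any bounded
    subsolution that starts below v_0; the Lyapunov function needed there is
    the first row plus the number of rows, whose drift is bounded because the
    rates a_k are.  The subsolution is a Poisson mixture of the first r iterates
    of the transition kernel of the confined chain, the remaining mass being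
    placed on the minimum of the r-th iterate ([mixture_generator]); for large t
    only that minimum is left, and for large r it approaches the stationary
    probability ([box_min_limit]).  Monotonicity is what makes the minimum of an
    iterate explicit: it is the value at the empty diagram. *)

(** * Young diagrams and attempted moves *)

Definition young : set (nat -> nat) :=
  [set y | (forall k, (y k.+1 <= y k)%N) /\
           exists n, forall k, (n <= k)%N -> y k = 0%N].

Definition addable (y : nat -> nat) (k : nat) : bool :=
  (k == 0%N) || (y k < y k.-1)%N.

Definition removable (y : nat -> nat) (k : nat) : bool := (y k.+1 < y k)%N.

(** The label (true, k) stands for an attempted left jump of particle k and
    (false, k) for an attempted right jump; a suppressed attempt is the identity,
    which keeps the maps total and monotone. *)
Definition step (i : bool * nat) (y : nat -> nat) : nat -> nat := fun j =>
  if i.1 then (y j + ((j == i.2) && addable y i.2))%N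
  else (y j - ((j == i.2) && removable y i.2))%N.

Definition crop (N L : nat) (y : nat -> nat) : nat -> nat := fun j =>
  if (j < N)%N then minn (y j) L else 0%N.

Definition le_rows (y z : nat -> nat) : Prop := forall j, (y j <= z j)%N.

Definition increasing_rows {R : realType} (f : (nat -> nat) -> R) : Prop :=
  forall y z, le_rows y z -> f y <= f z.

(** Attractiveness: if y_k < z_k, a single cell cannot reverse the order of the
    k-th rows; if y_k = z_k, a growth allowed for y is allowed for z, because
    z_(k-1) >= y_(k-1), and dually for a removal. *)
Lemma step_mono i y z : le_rows y z -> le_rows (step i y) (step i z).
Proof.
case: i => s k yz j; rewrite /step /addable /removable /=.
have /= := yz k; have /= := yz k.-1; have /= := yz k.+1; have := yz j.
by case: s; case: (eqVneq j k) => [->|]; lia.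
Qed.

Lemma step_young i y : young y -> young (step i y).
Proof.
case: i => s k [yd [n yn]]; split.
  move=> j; rewrite /step /addable /removable /=.
  have := yd j; have := yd k; have := yd k.-1.
  by case: s; case: (eqVneq j k) => [->|]; case: (eqVneq j.+1 k) => [<-|] /=; lia.
exists (maxn n k.+1) => j; rewrite geq_max => /andP[nj kj].
rewrite /step yn //; have -> : (j == k) = false by lia.
by case: s; rewrite /= ?addn0 ?subn0.
Qed.

Lemma young_nonincreasing y j k : young y -> (j <= k)%N -> (y k <= y j)%N.
Proof.
move=> [yd _]; elim: k => [|k IH]; first by rewrite leqn0 => /eqP ->.
by rewrite leq_eqVlt => /orP[/eqP->//|/IH]; exact: leq_trans.
Qed.

Lemma crop_le N L y : le_rows (crop N L y) y.
Proof. by move=> j; rewrite /crop; case: ifP => // _; exact: geq_minl. Qed.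

Lemma crop_mono N L y z : le_rows y z -> le_rows (crop N L y) (crop N L z).
Proof. by move=> yz j; have := yz j; rewrite /crop; case: ifP => //; lia. Qed.

Lemma crop_idem N L y : crop N L (crop N L y) = crop N L y.
Proof. by apply/funext => j; rewrite /crop; case: ltnP => //= jN; rewrite -minnA minnn. Qed.

Lemma crop_step_far N L s k y : (N <= k)%N -> crop N L (step (s, k) y) = crop N L y.
Proof.
move=> Nk; apply/funext => j; rewrite /crop; case: ltnP => // jN.
rewrite /step /=; have -> : (j == k) = false by lia.
by case: s; rewrite /= ?addn0 ?subn0.
Qed.

(** Number of nonzero rows.  The characterisation used to select it fails for
    sequences that are not diagrams, where the value is the default 0. *)
Definition len (y : nat -> nat) : nat :=
  xget 0%N [set n | forall k, (y k == 0%N) = (n <= k)%N].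

Lemma lenP y : young y -> forall k, (y k == 0%N) = (len y <= k)%N.
Proof.
move=> yy; rewrite /len; case: xgetP => [n _ //|nope].
case: (yy) => yd [n0 yn0].
have ex : exists n, y n == 0%N by exists n0; rewrite yn0.
case: (nope (ex_minn ex)) => k; case: ex_minnP => m /eqP ym mmin.
apply/idP/idP => [/mmin//|mk]; rewrite -leqn0 -ym.
exact: young_nonincreasing.
Qed.

Lemma len_le y n : young y -> y n = 0%N -> (len y <= n)%N.
Proof. by move=> yy yn; rewrite -lenP// yn. Qed.

Lemma len0 y k : young y -> (len y <= k)%N -> y k = 0%N.
Proof. by move=> yy; rewrite -lenP// => /eqP. Qed.

Lemma step_past_len y s k : young y -> (len y < k)%N -> step (s, k) y = y.
Proof.
move=> yy lk; apply/funext => j; rewrite /step /addable /removable /=.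
have -> : y k = 0%N by apply: len0 => //; lia.
have -> : y k.-1 = 0%N by apply: len0 => //; lia.
by case: s; case: (j == k) => /=; lia.
Qed.

Definition moves (n : nat) : seq (bool * nat) :=
  [seq (s, k) | s <- [:: true; false], k <- iota 0 n].

Lemma mem_moves n i : (i \in moves n) = (i.2 < n)%N.
Proof.
case: i => s k; apply/allpairsP/idP => /= [[[t l] /= [_]]|kn].
  by rewrite mem_iota => /andP[_ ln] [_ ->].
by exists (s, k); split => //=; [case: s | rewrite mem_iota].
Qed.

Lemma moves_uniq n : uniq (moves n).
Proof. by apply: allpairs_uniq => //; [exact: iota_uniq | move=> [? ?] [? ?]]. Qed.

Lemma sum_moves {R : realType} n (F : bool * nat -> R) :
  \sum_(i <- moves n) F i = \sum_(k < n) (F (true, k : nat) + F (false, k : nat)).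
Proof.
rewrite big_allpairs /= !big_cons big_nil addr0 big_split /=.
have -> : iota 0 n = index_iota 0 n by rewrite /index_iota subn0.
by rewrite !big_mkord.
Qed.

(** * Exclusion configurations as Young diagrams *)

Definition particles (c : int) (y : nat -> nat) : nat -> int :=
  fun k => c + k%:Z - (y k)%:Z.

Definition allowed (i : bool * nat) (y : nat -> nat) : bool :=
  if i.1 then addable y i.2 else removable y i.2.

Definition rate {R : realType} (a b : nat -> R) (i : bool * nat) : R :=
  if i.1 then a i.2 else b i.2.

Lemma particles_inj c : injective (particles c).
Proof.
move=> y z yz; apply/funext => k; have := congr1 (fun x => x k) yz.
by rewrite /particles; lia.
Qed.

Lemma particles_finite_configuration c y : young y -> finite_configuration (particles c y).
Proof.
move=> [yd [n yn]]; split.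
  by move=> k; rewrite /particles; have := yd k; lia.
apply: (@sub_finite_set _ _ `I_n) => [k /= k1|]; last exact: finite_II.
rewrite ltnNge; apply/negP => nk; move: k1; rewrite /particles !yn//; last by lia.
by lia.
Qed.

(** The offset c is the limit of x_k - k, which exists because all gaps but
    finitely many equal 1; as x_k - k is nondecreasing, y_k = c + k - x_k is
    a nonnegative nonincreasing sequence. *)
Lemma finite_configuration_particles x :
  finite_configuration x -> exists c y, young y /\ x = particles c y.
Proof.
move=> [xinc xfin].
have [n xn] : exists n, forall k, (n <= k)%N -> x k.+1 - x k = 1.
  have [s sE] := (finite_seqP _).1 xfin.
  exists (\max_(k <- s) k).+1 => k nk; apply/eqP/negPn/negP => k1.
  have : [set k | x k.+1 - x k != 1] k by [].
  rewrite sE /= => ks; suff: (k <= \max_(k <- s) k)%N by lia.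
  by rewrite (big_rem k)//= leq_maxl.
have tail k : (n <= k)%N -> x k = x n - n%:Z + k%:Z.
  elim: k => [|k IH]; first by rewrite leqn0 => /eqP ->; lia.
  rewrite leq_eqVlt => /orP[/eqP <-|]; first by lia.
  by rewrite ltnS => nk; have := xn k nk; rewrite IH//; lia.
have below k : (x k <= x n - n%:Z + k%:Z).
  have [/tail ->//|/ltnW kn] := leqP n k.
  elim: n kn {xn tail} => [|m IH]; first by rewrite leqn0 => /eqP ->; lia.
  rewrite leq_eqVlt => /orP[/eqP <-|]; first by lia.
  by rewrite ltnS => /IH; have := xinc m; lia.
exists (x n - n%:Z), (fun k => absz (x n - n%:Z + k%:Z - x k)%R); split; last first.
  by apply/funext => k; rewrite /particles; have := below k; lia.
split; last by exists n => k nk; rewrite (tail _ nk); lia.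
by move=> k; have := below k; have := below k.+1; have := xinc k; lia.
Qed.

(** Only the immediate left neighbour can occupy the target site. *)
Lemma vacant_left c y k : young y ->
  vacant (particles c y) (particles c y k - 1) <-> addable y k.
Proof.
move=> yy; split; rewrite /vacant /addable /particles.
  by case: k => [//|k] /(_ k) /=; have [/(_ k)] := yy; lia.
move=> yk j; have [jk|kj] := ltnP j k; last first.
  by have := young_nonincreasing yy kj; lia.
have jk1 : (j <= k.-1)%N by lia.
by have := young_nonincreasing yy jk1; lia.
Qed.

Lemma vacant_right c y k : young y ->
  vacant (particles c y) (particles c y k + 1) <-> removable y k.
Proof.
move=> yy; split; rewrite /vacant /removable /particles.
  by move=> /(_ k.+1); have [/(_ k)] := yy; lia.
move=> yk j; have [kj|jk] := ltnP k j.
  by have := young_nonincreasing yy kj; lia.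
by have := young_nonincreasing yy jk; lia.
Qed.

Lemma hop_left c y k : addable y k ->
  hop (particles c y) k (-1) = particles c (step (true, k) y).
Proof.
move=> yk; apply/funext => j; rewrite /hop /particles /step /= yk andbT.
by case: eqVneq => [->|_]; lia.
Qed.

Lemma hop_right c y k : removable y k ->
  hop (particles c y) k 1 = particles c (step (false, k) y).
Proof.
move=> yk; apply/funext => j; rewrite /hop /particles /step /= yk andbT.
by move: yk; rewrite /removable; case: eqVneq => [->|_]; lia.
Qed.

Lemma hop_inj x j k d e : d != 0 -> hop x j d = hop x k e -> j = k /\ d = e.
Proof.
move=> d0 E; have Ej := congr1 (fun z => z j) E; move: Ej.
by rewrite /hop eqxx; case: eqVneq => [->|_]; lia.
Qed.

Lemma stepE i y j : allowed i y ->
  (step i y j)%:Z = (y j)%:Z + (if i.1 then 1 else -1) * (j == i.2)%:Z.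
Proof.
rewrite /allowed /step; case: i => -[] k /= yk; rewrite yk andbT; first by lia.
by move: yk; rewrite /removable; case: eqVneq => [->|_]; lia.
Qed.

Lemma step_blocked i y : ~~ allowed i y -> step i y = y.
Proof.
rewrite /allowed /step => yi; apply/funext => j; case: i yi => -[] k /= /negbTE ->.
  by rewrite andbF addn0.
by rewrite andbF subn0.
Qed.

Lemma step_allowed_neq i y : allowed i y -> step i y <> y.
Proof. by move=> yi E; have := stepE (i.2) yi; rewrite E; case: ifP; lia. Qed.

(** Distinct effective moves lead to distinct states, so that every transition
    rate of the exclusion process comes from a single move. *)
Lemma step_inj i j y : allowed i y -> allowed j y -> step i y = step j y -> i = j.
Proof.
move=> yi yj E; have := stepE i.2 yi; rewrite E stepE// eqxx.
case: i {yi E} => si ki; case: j {yj} => sj kj /=.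
by case: eqVneq => [->|_]; case: si; case: sj => //; lia.
Qed.

Section Rates.
Context {R : realType}.
Variables a b : nat -> R.
Implicit Type y : nat -> nat.

Lemma allowed_le_len i y : young y -> allowed i y -> (i.2 <= len y)%N.
Proof.
move=> yy; rewrite leqNgt; apply: contraTN => ki.
by apply/negP => /step_allowed_neq; case: i ki => s k ki; apply; exact: step_past_len.
Qed.

(** Particles beyond the first zero row are packed and cannot move, hence the
    range of moves: k = len y is the last row that may grow. *)
Lemma exit_rateE c y : young y ->
  exit_rate a b (particles c y) =
  \sum_(i <- moves (len y).+1 | allowed i y) rate a b i.
Proof.
move=> yy; rewrite /exit_rate [RHS]big_mkcond sum_moves.
rewrite -(@fsbig_widen _ _ _ _ `I_((len y).+1)) //; last first.
  move=> k [_] /= kl.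
  have al s : ~~ allowed (s, k) y.
    by apply/negP => /(allowed_le_len yy).
  rewrite !asboolF ?mulr0 ?addr0//.
    by move/vacant_right => /(_ yy); exact/negP/(al false).
  by move/vacant_left => /(_ yy); exact/negP/(al true).
rewrite -fsbig_ord; apply: eq_bigr => k _.
rewrite (asbool_equiv_eq (vacant_left c k yy)).
rewrite (asbool_equiv_eq (vacant_right c k yy)) !asboolb /allowed /rate /=.
by case: ifP; case: ifP; rewrite ?mulr1 ?mulr0.
Qed.

Lemma jump_rateE c y i : young y -> allowed i y ->
  jump_rate a b (particles c y) (particles c (step i y)) = rate a b i.
Proof.
move=> yy yi; rewrite /jump_rate -(@fsbig_widen _ _ _ _ [set i.2]) //; last first.
  move=> k [_] /= ki; rewrite !asboolF ?mulr0 ?addr0//.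
    by case: i yi ki => -[] l /= yl lk [_]; rewrite -?hop_left -?hop_right// => /hop_inj[]// /esym.
  by case: i yi ki => -[] l /= yl lk [_]; rewrite -?hop_left -?hop_right// => /hop_inj[]// /esym.
rewrite fsbig_set1; case: i yi => -[] k /= yk; rewrite /rate /=.
  rewrite asboolT ?asboolF ?mulr1 ?mulr0 ?addr0 //.
    by rewrite -hop_left// => -[_ /hop_inj[]].
  by split; [exact/vacant_left|rewrite hop_left].
rewrite asboolF ?asboolT ?mulr1 ?mulr0 ?add0r //.
  by split; [exact/vacant_right|rewrite hop_right].
by rewrite -hop_right// => -[_ /hop_inj[]].
Qed.

End Rates.

(** * Short-time lower bound for transition probabilities *)

Section Backward.
Context {R : realType} {T : choiceType}.
Variables (S : set T) (Q : T -> T -> R) (p : R -> T -> T -> R).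
Hypotheses (tf : transition_function S p) (hr : has_rates S Q p).

Definition mass (B : set T) (t : R) (x : T) : R :=
  fine (\esum_(z in S `&` B) (p t x z)%:E)%E.

Lemma mass_esum B t x : 0 <= t -> S x ->
  (mass B t x)%:E = (\esum_(z in S `&` B) (p t x z)%:E)%E /\ mass B t x <= 1.
Proof.
move=> t0 Sx.
have ge0 : (0 <= \esum_(z in S `&` B) (p t x z)%:E)%E.
  by apply: esum_ge0 => z [Sz _]; rewrite lee_fin; exact: (tf_ge0 tf).
have le1 : (\esum_(z in S `&` B) (p t x z)%:E <= 1)%E.
  rewrite -(tf_sum1 tf t0 Sx) [leRHS](esumID B)//.
    by apply: leeDl; apply: esum_ge0 => z [Sz _]; rewrite lee_fin; exact: (tf_ge0 tf).
  by move=> z Sz; rewrite lee_fin; exact: (tf_ge0 tf).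
have fin : (\esum_(z in S `&` B) (p t x z)%:E)%E \is a fin_num.
  by rewrite ge0_fin_numE// (le_lt_trans le1)// ltry.
by split; rewrite /mass ?fineK// -lee_fin fineK.
Qed.

Lemma mass_ge0 B t x : 0 <= t -> S x -> 0 <= mass B t x.
Proof.
move=> t0 Sx; apply: fine_ge0; apply: esum_ge0 => z [Sz _].
by rewrite lee_fin; exact: (tf_ge0 tf).
Qed.

Lemma le_scale_esum (A : set T) (u : T -> R) (c : R) : 0 <= c ->
  (c%:E * (\esum_(z in A) (u z)%:E) <= \esum_(z in A) (c * u z)%:E)%E.
Proof.
rewrite le_eqVlt => /orP[/eqP <-|c0].
  by rewrite mul0e; apply: esum_ge0 => z _; rewrite mul0r.
rewrite -lee_pdivlMl//; apply: ge_ereal_sup => _ /= [F [finF FA] <-].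
rewrite lee_pdivlMl// fsbig_finite// sumEFin -EFinM mulr_sumr -sumEFin -fsbig_finite//.
by apply: ereal_sup_ubound; exists F.
Qed.

(** Half of the Chapman-Kolmogorov equation: only the intermediate states in a
    finite list J are kept, which avoids any exchange of infinite sums. *)
Lemma mass_add B s t x (J : seq T) : 0 <= s -> 0 <= t -> S x -> uniq J ->
  (forall y, y \in J -> S y) ->
  \sum_(y <- J) p s x y * mass B t y <= mass B (s + t) x.
Proof.
move=> s0 t0 Sx uJ JS; have st0 : 0 <= s + t by exact: addr_ge0.
rewrite -lee_fin (mass_esum B st0 Sx).1 -sumEFin.
apply: (@le_trans _ _
    (\sum_(y <- J) \esum_(z in S `&` B) (p s x y * p t y z)%:E)%E).
  rewrite !big_seq; apply: lee_sum => y yJ; rewrite EFinM.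
  rewrite (mass_esum B t0 (JS _ yJ)).1.
  by apply: le_scale_esum; apply: (tf_ge0 tf) => //; exact: JS.
rewrite big_seq -esum_sum; last first.
  move=> z y [Sz _] yJ; rewrite lee_fin.
  by rewrite mulr_ge0// (tf_ge0 tf)//; exact: JS.
apply: le_esum => z [Sz _]; rewrite -big_seq (tf_chapman_kolmogorov tf)//.
apply: esum_ge; exists [set` J]; first by split; [exact: finite_seq|].
by rewrite fsbig_seq.
Qed.

Lemma rates_near (s : seq T) x (eta : R) : S x -> (forall y, y \in s -> S y) -> 0 < eta ->
  \forall h \near 0^'+, forall y, y \in s ->
    (x == y)%:R + h * (Q x y - eta) <= p h x y.
Proof.
move=> Sx sS eta0; elim: s sS => [|y s IH] sS; first by near=> h => ?.
have Sy : S y by apply: sS; rewrite mem_head.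
have {}IH : \forall h \near 0^'+, forall z, z \in s ->
    (x == z)%:R + h * (Q x z - eta) <= p h x z.
  by apply: IH => z zs; apply: sS; rewrite inE zs orbT.
have := hr Sx Sy => /cvgrPdist_lt /(_ _ eta0) near_y.
near=> h => z; rewrite inE => /orP[/eqP ->|]; last first.
  by move: z; near: h; exact: IH.
have h0 : 0 < h by near: h; exact: nbhs_right_gt.
have : `|Q x y - (p h x y - (x == y)%:R) / h| < eta by near: h; exact: near_y.
move=> /ltr_distlDr; rewrite -ltrBlDr ltr_pdivlMr// => /ltW.
by rewrite mulrC lerBrDl.
Unshelve. all: by end_near. Qed.

(** Keep only the paths that, during [0, h], stay at x or make one of the finitely
    many jumps; their probabilities are 1 + h Q x x and h Q x (z i) up to o(h).
    The error is uniform in t because masses lie in [0, 1]. *)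
Lemma mass_backward {K : eqType} B (I : seq K) (z : K -> T) (r : K -> R) x (eps : R) :
  S x -> (forall i, i \in I -> S (z i)) -> (forall i, i \in I -> z i != x) ->
  uniq I -> {in I &, injective z} ->
  (forall i, i \in I -> Q x (z i) = r i) -> Q x x = - \sum_(i <- I) r i ->
  0 < eps ->
  exists2 h0, 0 < h0 & forall t h, 0 <= t -> 0 < h -> h < h0 ->
    mass B t x + h * (\sum_(i <- I) r i * (mass B t (z i) - mass B t x) - eps)
    <= mass B (t + h) x.
Proof.
move=> Sx zS zx uI zinj Qz Qx eps0.
(* each of the size J transition probabilities may be off by h * eta *)
pose J := x :: map z I; pose eta : R := eps / (size J)%:R.
have eta0 : 0 < eta by rewrite divr_gt0// ltr0n.
have JS y : y \in J -> S y.
  by rewrite inE => /orP[/eqP->//|/mapP[i iI ->]]; exact: zS.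
have uJ : uniq J.
  rewrite /= map_inj_in_uniq// uI andbT; apply/mapP => -[i iI xE].
  by have := zx _ iI; rewrite -xE eqxx.
have := rates_near Sx JS eta0; rewrite near_withinE.
move=> /nbhs_ballP[h0 /= h00 near_h0]; exists h0 => // t h t0 hgt0 hlt.
have ph := near_h0 h; rewrite /ball/= sub0r normrN gtr0_norm// in ph.
have {}ph := ph hlt hgt0.
rewrite (addrC t h); apply: le_trans (mass_add B (ltW hgt0) t0 Sx uJ JS).
apply: (@le_trans _ _ (\sum_(y <- J) ((x == y)%:R + h * (Q x y - eta)) * mass B t y)); last first.
  rewrite !big_seq; apply: ler_sum => y yJ; apply: ler_wpM2r; last exact: ph.
  by apply: mass_ge0 => //; exact: JS.
have m1 y : S y -> mass B t y <= 1 by move=> Sy; exact: (mass_esum B t0 Sy).2.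
have sizeJ : eta * (size I)%:R + eta = eps.
  rewrite /eta /= size_map -[X in _ + X]mulr1 -mulrDr natr1 divfK// pnatr_eq0.
rewrite big_cons eqxx Qx big_map.
set m := mass B t.
have : \sum_(i <- I) (h * (r i * m (z i)) - h * eta) <=
       \sum_(i <- I) ((x == z i)%:R + h * (Q x (z i) - eta)) * m (z i).
  rewrite !big_seq; apply: ler_sum => i iI.
  rewrite eq_sym (negbTE (zx _ iI)) add0r Qz// mulrBr mulrBl -mulrA lerD2l lerN2.
  rewrite -[leRHS]mulr1; apply: ler_wpM2l; first by rewrite mulr_ge0// ltW.
  by apply: m1; exact: zS.
rewrite sumrB -mulr_sumr big_const_seq count_predT iter_addr_0 -[_ *+ size I]mulr_natr.
have -> : \sum_(i <- I) r i * (m (z i) - m x) =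
    \sum_(i <- I) r i * m (z i) - (\sum_(i <- I) r i) * m x.
  by rewrite mulr_suml -sumrB; apply: eq_bigr => i _; rewrite mulrBr.
have : h * eta * m x <= h * eta.
  rewrite -[leRHS]mulr1; apply: ler_wpM2l; last exact: m1.
  by rewrite mulr_ge0// ltW.
rewrite -sizeJ; set A := \sum_(i <- I) r i * m (z i); set C := \sum_(i <- I) r i.
rewrite mulr1n; nra.
Qed.
End Backward.

(** * A minimum principle for countable chains *)

Definition generator {R : realType} {K I : Type} (J : I -> seq K) (r : K -> R)
    (act : K -> I -> I) (f : I -> R) (y : I) : R :=
  \sum_(i <- J y) r i * (f (act i y) - f y).

Lemma finite_common_step {R : realType} {I : choiceType} (F : set I)
    (P : I -> R -> Prop) : finite_set F ->
  (forall y, F y -> exists2 h0, 0 < h0 & forall h, 0 < h -> h < h0 -> P y h) ->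
  exists2 h0, 0 < h0 & forall h, 0 < h -> h < h0 -> forall y, F y -> P y h.
Proof.
move=> /finite_seqP[s ->] /=; elim: s => [|y s IH] ex; first by exists 1.
have [|h1 h10 H1] := ex y; first exact: mem_head.
have [z zs|h2 h20 H2] := IH; first by apply: ex; rewrite inE zs orbT.
exists (Num.min h1 h2); first by rewrite lt_min h10.
move=> h h0; rewrite lt_min => /andP[hh1 hh2] z.
by rewrite inE => /orP[/eqP ->|]; [exact: H1|exact: H2].
Qed.

(** V is a Lyapunov function: adding eps (V + (C + 1) t) to U pushes a possible
    negative minimum into a finite sublevel set of V, where the local growth
    estimate holds with a common time step. *)
Section MinimumPrinciple.
Context {R : realType} {K : Type} {I : choiceType}.
Variables (D : set I) (J : I -> seq K) (r : K -> R) (act : K -> I -> I).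
Hypotheses (r_ge0 : forall i, 0 <= r i) (actD : forall i y, D y -> D (act i y)).
Local Notation L := (generator J r act).

(** A nonnegative function can decrease at y only through the exit term. *)
Lemma generator_ge f y : D y -> (forall z, D z -> 0 <= f z) ->
  - (\sum_(i <- J y) r i) * f y <= L f y.
Proof.
move=> Dy f0; rewrite mulNr mulr_suml -sumrN; apply: ler_sum => i _.
by rewrite mulrBr -[leLHS]add0r lerD2r mulr_ge0// f0//; exact: actD.
Qed.

Variables (V : I -> R) (C : R).
Hypotheses (V0 : forall y, D y -> 0 <= V y) (LV : forall y, D y -> L V y <= C)
  (C0 : 0 <= C) (V_proper : forall v, finite_set [set y | D y /\ V y <= v]).

Variables (U : R -> I -> R) (b : R).
Hypotheses (U_bounded : forall t y, 0 <= t -> D y -> - b <= U t y)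
  (U_start : forall y, D y -> 0 <= U 0 y)
  (U_growth : forall y eps, D y -> 0 < eps -> exists2 h0, 0 < h0 &
     forall t h, 0 <= t -> 0 < h -> h < h0 ->
       U t y + h * (L (U t) y - eps) <= U (t + h) y).

(** Divide [0, t] into n steps of length h.  Outside the sublevel set F the lower
    bound on U suffices; on F one step multiplies the perturbed function by at
    least 1 - h q(y) >= 0 and adds a nonnegative amount, since the slope C + 1 in
    time pays for the drift of V and for the error eps. *)
Lemma minimum_principle_eps eps t y : 0 < eps -> 0 <= t -> D y ->
  0 <= U t y + eps * (V y + (C + 1) * t).
Proof.
move=> eps0; rewrite le_eqVlt => /orP[/eqP <- Dy|t0].
  by rewrite mulr0 addr0 addr_ge0 ?U_start// mulr_ge0 ?V0// ltW.
move: y; pose F := [set y | D y /\ V y <= b / eps].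
pose q y := \sum_(i <- J y) r i.
have q0 y : 0 <= q y by exact: sumr_ge0.
have [h0 h00 H] : exists2 h0, 0 < h0 & forall h, 0 < h -> h < h0 ->
    forall y, F y -> h * q y <= 1 /\ forall s, 0 <= s ->
      U s y + h * (L (U s) y - eps) <= U (s + h) y.
  apply: (finite_common_step (P := fun y h => h * q y <= 1 /\ forall s, 0 <= s ->
      U s y + h * (L (U s) y - eps) <= U (s + h) y)); first exact: V_proper.
  move=> y [Dy _]; have [h1 h10 H1] := U_growth Dy eps0.
  have q1 : 0 < q y + 1 by rewrite ltr_wpDl.
  exists (Num.min h1 (q y + 1)^-1); first by rewrite lt_min h10 invr_gt0.
  move=> h h0; rewrite lt_min => /andP[hh1 hq]; split; last by move=> s s0; exact: H1.
  have : h * (q y + 1) <= 1 by rewrite -ler_pdivlMr// div1r ltW.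
  by rewrite mulrDr mulr1; apply: le_trans; rewrite lerDl ltW.
pose n := (Num.trunc (t / h0)).+1; pose h := t / n%:R.
have n0 : 0 < n%:R :> R by rewrite ltr0n.
have hgt0 : 0 < h by rewrite divr_gt0.
have hlt : h < h0 by rewrite ltr_pdivrMr// mulrC -ltr_pdivrMr// truncnS_gt.
suff main m y : D y -> 0 <= U (m%:R * h) y + eps * (V y + (C + 1) * (m%:R * h)).
  by move=> y Dy; have := main n y Dy; rewrite /h mulrC divfK// gt_eqF.
elim: m y => [|m IH] y Dy.
  by rewrite mul0r mulr0 addr0 addr_ge0 ?U_start// mulr_ge0 ?V0// ltW.
have mh0 : 0 <= m%:R * h by rewrite mulr_ge0// ltW.
have [Vb|bV] := leP (V y) (b / eps); last first.
  have : - b <= U (m.+1%:R * h) y by apply: U_bounded => //; rewrite mulr_ge0// ltW.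
  move: bV; rewrite ltr_pdivrMr// => bV.
  have : 0 <= eps * ((C + 1) * (m.+1%:R * h)).
    by rewrite !mulr_ge0// ?addr_ge0// ltW.
  by rewrite mulrDr; lra.
have [hq /(_ _ mh0)] := H _ hgt0 hlt y (conj Dy Vb).
rewrite -natr1 (mulrDl m%:R 1 h) mul1r; move: (m%:R * h) mh0 IH => s s0 IH Us.
(* constants in space are killed by L, so only V contributes to L Psi *)
pose Psi z := U s z + eps * (V z + (C + 1) * s).
have LPsi : L Psi y = L (U s) y + eps * L V y.
  by rewrite /generator mulr_sumr -big_split; apply: eq_bigr => i _; rewrite /Psi /=; ring.
have := generator_ge Dy IH; rewrite -/(L Psi y) LPsi -/(q y) -/(Psi y).
have := IH y Dy; rewrite -/(Psi y) => Psi0.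
have -> : U (s + h) y + eps * (V y + (C + 1) * (s + h)) =
   Psi y + (U (s + h) y - U s y + eps * (C + 1) * h) by rewrite /Psi; ring.
have eLV : eps * L V y <= eps * C by rewrite ler_pM2l// LV.
have hqPsi : h * q y * Psi y <= Psi y by rewrite ler_piMl.
move: (L (U s) y) (L V y) eLV Us => u v eLV Us uv.
have huv : h * (- q y * Psi y) <= h * (u + eps * v) by rewrite ler_pM2l.
have hv : h * (eps * v) <= h * (eps * C) by rewrite ler_pM2l.
lra.
Qed.

Lemma minimum_principle t y : 0 <= t -> D y -> 0 <= U t y.
Proof.
move=> t0 Dy; rewrite leNgt; apply/negP => U0.
pose c := V y + (C + 1) * t + 1.
have c0 : 0 < c by rewrite ltr_wpDl// addr_ge0 ?V0// mulr_ge0// addr_ge0.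
(* with this eps the perturbation is at most half of - U t y *)
have eps0 : 0 < - U t y / (2 * c) by rewrite divr_gt0 ?oppr_gt0 ?mulr_gt0.
have := minimum_principle_eps eps0 t0 Dy; rewrite leNgt => /negP; apply.
have : - U t y / (2 * c) * c = - U t y / 2 by field; rewrite gt_eqF.
by move: eps0; set e := - U t y / (2 * c); rewrite /c; nra.
Qed.
End MinimumPrinciple.

(** * Poisson weights *)

Section PoissonWeights.
Context {R : realType}.
Implicit Types s h : R.

Lemma taylor1_le (f f1 f2 : R -> R) (B s h : R) :
  (forall x : R, is_derive x 1 f (f1 x)) -> (forall x : R, is_derive x 1 f1 (f2 x)) ->
  (forall x, 0 <= x -> `|f2 x| <= B) -> 0 <= s -> 0 <= h ->
  `|f (s + h) - f s - h * f1 s| <= B * h ^+ 2.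
Proof.
move=> df df1 f2B s0 h0.
have cont (g g1 : R -> R) u v : (forall x : R, is_derive x 1 g (g1 x)) ->
    {within `[u, v], continuous g}.
  move=> dg; apply: continuous_subspaceT => x.
  by apply: differentiable_continuous; apply/derivable1_diffP; case: (dg x).
have [|c cs ->] := @MVT_segment R f f1 s (s + h) _ (fun x _ => df x) (cont _ _ _ _ df).
  by rewrite lerDl.
move: cs; rewrite in_itv /= => /andP[sc ch].
have [x xs E] := @MVT_segment R f1 f2 s c sc (fun x _ => df1 x) (cont _ _ _ _ df1).
move: xs; rewrite in_itv /= => /andP[sx xc].
rewrite [s + h]addrC addrK [f1 c * h]mulrC -mulrBr E !normrM (ger0_norm h0).
have := f2B x (le_trans s0 sx); have x0 := normr_ge0 (f2 x) => f2x.
rewrite (@ger0_norm _ (c - s)) ?subr_ge0//.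
have chs : c - s <= h by lra.
have : `|f2 x| * (c - s) <= B * h by apply: ler_pM => //; rewrite subr_ge0.
by rewrite expr2; nra.
Qed.

Definition weight (n : nat) (s : R) : R := s ^+ n / n`!%:R * expR (- s).

Definition dweight (n : nat) (s : R) : R :=
  (if n is m.+1 then weight m s else 0) - weight n s.

Lemma weight_ge0 n s : 0 <= s -> 0 <= weight n s.
Proof. by move=> s0; rewrite /weight !mulr_ge0 ?exprn_ge0 ?expR_ge0. Qed.

(** Both this bound and the decay below compare s^n / n! with a single term of
    the exponential series. *)
Lemma weight_le1 n s : 0 <= s -> weight n s <= 1.
Proof.
move=> s0; rewrite /weight expRN ler_pdivrMr ?expR_gt0// mul1r.
case: n => [|n]; first by rewrite expr0 fact0 divr1 -[leLHS]expR0 ler_expR.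
by apply: le_trans (expR_ge1Dxn n s0); rewrite lerDr.
Qed.

Lemma weight_start n : weight n 0 = (n == 0%N)%:R.
Proof.
by rewrite /weight oppr0 expR0 mulr1 expr0n; case: n => [|n]; rewrite ?fact0 ?divr1 ?mul0r.
Qed.

Lemma dweight_le1 n s : 0 <= s -> `|dweight n s| <= 1.
Proof.
move=> s0; rewrite ler_norml /dweight; case: n => [|n].
  by have := weight_ge0 0 s0; have := weight_le1 0 s0; lra.
by have := weight_ge0 n s0; have := weight_le1 n s0; have := weight_ge0 n.+1 s0;
  have := weight_le1 n.+1 s0; lra.
Qed.

Lemma is_derive_weight n s : is_derive s 1 (weight n) (dweight n s).
Proof.
have dexp : is_derive s 1 (fun x : R => expR (- x)) (- expR (- s)).
  by rewrite -mulrN1; apply: (@is_derive1_comp R expR -%R s).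
case: n => [|n].
  have -> : weight 0 = fun x => expR (- x).
    by apply/funext => x; rewrite /weight expr0 fact0 divr1 mul1r.
  by rewrite /dweight sub0r /weight expr0 fact0 divr1 mul1r.
have -> : weight n.+1 =
    ((n.+1)`!%:R^-1 : R) \*: ((@id R ^+ n.+1) * (fun x => expR (- x))).
  apply/funext => x; rewrite /weight /= /GRing.scale /= mulrA.
  by rewrite fctE [_^-1 * _]mulrC.
apply: is_derive_eq.
have -> : (@id R ^+ n.+1) s = s * s ^+ n by rewrite fctE exprS.
rewrite /GRing.scale /= /dweight /weight factS natrM exprS.
have n1 : n.+1%:R != 0 :> R by rewrite pnatr_eq0.
have nf : n`!%:R != 0 :> R by rewrite pnatr_eq0 -lt0n fact_gt0.
by move: (n.+1%:R : R) n1 (n`!%:R : R) nf => u u0 v v0; field; rewrite u0 v0.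
Qed.

Lemma is_derive_dweight n s : is_derive s 1 (dweight n)
  ((if n is m.+1 then dweight m s else 0) - dweight n s).
Proof.
have dn := is_derive_weight n s.
case: n dn => [|n] dn.
  by apply: is_deriveB; exact: is_derive_cst.
by have dm := is_derive_weight n s; exact: is_deriveB.
Qed.

Lemma weight_increment n s h : 0 <= s -> 0 <= h ->
  `|weight n (s + h) - weight n s - h * dweight n s| <= 2 * h ^+ 2.
Proof.
apply: taylor1_le => [x|x|x x0]; [exact: is_derive_weight|exact: is_derive_dweight|].
apply: (le_trans (ler_normB _ _)); have := dweight_le1 n x0.
case: n => [|n]; first by rewrite normr0; lra.
by have := dweight_le1 n x0; lra.
Qed.

Lemma weight_decay n (eps : R) : 0 < eps ->
  exists2 s0, 0 < s0 & forall s, s0 <= s -> weight n s <= eps.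
Proof.
move=> eps0; exists (n.+1%:R / eps); first by rewrite divr_gt0// ltr0n.
move=> s; rewrite ler_pdivrMr// => ns.
have s0 : 0 < s by rewrite -(pmulr_lgt0 _ eps0); apply: lt_le_trans ns; rewrite ltr0n.
rewrite /weight expRN ler_pdivrMr ?expR_gt0//.
have := expR_ge1Dxn n (ltW s0); rewrite factS natrM exprS => H.
have nf : 0 < n`!%:R :> R by rewrite ltr0n fact_gt0.
have n1 : 0 < n.+1%:R :> R by rewrite ltr0n.
have {}H : s * (s ^+ n / n`!%:R) <= n.+1%:R * expR s.
  rewrite -ler_pdivrMl//; apply: le_trans H; rewrite ler_wpDl//.
  by rewrite le_eqVlt; apply/orP; left; apply/eqP; field; rewrite !gt_eqF.
rewrite -(ler_pM2l s0); apply: le_trans H _.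
by rewrite mulrA ler_wpM2r ?expR_ge0.
Qed.
End PoissonWeights.

(** * The generator and the chain confined to a box *)

Lemma sum_moves_widen {R : realType} n m (F : bool * nat -> R) : (n <= m)%N ->
  (forall i, (n <= i.2)%N -> F i = 0) ->
  \sum_(i <- moves n) F i = \sum_(i <- moves m) F i.
Proof.
move=> nm F0; rewrite !sum_moves.
rewrite -!(big_mkord xpredT (fun k => F (true, k) + F (false, k))).
rewrite [RHS](big_cat_nat (leq0n n) nm)/=.
rewrite [X in _ = _ + X]big_nat_cond [X in _ = _ + X]big1 ?addr0//.
by move=> k /andP[/andP[nk _] _]; rewrite !F0 ?addr0.
Qed.

Lemma bounded_rows_finite N L :
  finite_set [set y : nat -> nat | (forall k, (y k <= L)%N) /\
                                   forall k, (N <= k)%N -> y k = 0%N].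
Proof.
pose rows (g : {ffun 'I_N -> 'I_L.+1}) : nat -> nat :=
  fun k => if insub k is Some i then g i : nat else 0%N.
apply: (@sub_finite_set _ _ (rows @` setT)); last exact/finite_image/finite_finset.
move=> y [yL y0]; exists [ffun i : 'I_N => inord (y i)] => //.
apply/funext => k; rewrite /rows; case: insubP => [i _ <-|].
  by rewrite ffunE inordK// ltnS.
by rewrite -leqNgt => /y0.
Qed.

Lemma sum_indicator_le1 {R : realType} n m :
  \sum_(k < n) ((k : nat) == m)%:R <= 1 :> R.
Proof.
suff -> : \sum_(k < n) ((k : nat) == m)%:R = (m < n)%:R :> R by rewrite lern1 leq_b1.
elim: n => [|n IH]; first by rewrite big_ord0.
by rewrite big_ord_recr /= IH -natrD; congr _%:R; lia.
Qed.

Section Chain.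
Context {R : realType}.
Variables a b : nat -> R.
Hypotheses (a_gt0 : forall k, 0 < a k) (b_gt0 : forall k, 0 < b k).
Implicit Types (f : (nat -> nat) -> R) (y z : nat -> nat).

Local Notation L := (generator (fun y => moves (len y).+1) (rate a b) step).

Lemma rate_gt0 i : 0 < rate a b i.
Proof. by rewrite /rate; case: ifP. Qed.

Section Barrier.
Variables (A : R) (a_le : forall k, a k <= A).

Definition barrier y : R := (y 0 + len y)%:R.

(** A move increases the first row only if it is a growth in row 0, and the number of
    rows only if it is a growth in row len y; each of the two happens at rate at most A. *)
Lemma barrier_generator_le y : young y -> L barrier y <= 2 * A.
Proof.
move=> yy; have A0 : 0 <= A := le_trans (ltW (a_gt0 0%N)) (a_le 0%N).
rewrite /generator sum_moves.
apply: (@le_trans _ _ (\sum_(k < (len y).+1)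
    A * (((k : nat) == 0%N)%:R + ((k : nat) == len y)%:R))); last first.
  rewrite -mulr_sumr big_split /= [2 * A]mulrC ler_wpM2l//.
  have := @sum_indicator_le1 R (len y).+1 0.
  by have := @sum_indicator_le1 R (len y).+1 (len y); lra.
apply: ler_sum => -[k /= kl] _; rewrite -[leRHS]addr0; apply: lerD; last first.
  apply: mulr_ge0_le0; first exact/ltW/rate_gt0.
  rewrite subr_le0 ler_nat leq_add//; first by rewrite /step /=; lia.
  apply: len_le; first exact: step_young.
  by rewrite /step /= (len0 yy).
apply: (@le_trans _ _ (a k * (((k == 0%N) + (k == len y))%N)%:R)); last first.
  by rewrite -natrD ler_wpM2r.
rewrite ler_pM2l ?rate_gt0// lerBlDl -natrD ler_nat.
have : (step (true, k) y 0 <= y 0 + (k == 0%N))%N.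
  by rewrite /step /=; case: (eqVneq k 0%N) => [->|k0]; case: addable; lia.
move=> h0; suff h1 : (len (step (true, k) y) <= len y + (k == len y))%N.
  by apply: leq_trans (leq_add h0 h1) _; rewrite addnACA.
apply: len_le; first exact: step_young.
rewrite /step /= (len0 yy) ?leq_addr// add0n.
by case: (eqVneq k (len y)) => [->|kly]; case: eqVneq => //; lia.
Qed.

Lemma barrier_proper (v : R) : finite_set [set y | young y /\ barrier y <= v].
Proof.
apply: (sub_finite_set _ (bounded_rows_finite (Num.trunc v).+1 (Num.trunc v).+1)).
move=> y [yy yv]; have : (y 0 + len y < (Num.trunc v).+1)%N.
  by rewrite -(ltr_nat R); apply: le_lt_trans yv (truncnS_gt _).
move=> yn; split=> k; last by move=> nk; apply: len0 => //; lia.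
by have := young_nonincreasing yy (leq0n k); lia.
Qed.
End Barrier.

Section Box.
Variables (N H : nat) (N_gt0 : (0 < N)%N).
Local Notation crop := (crop N H).

Definition total_rate : R := \sum_(i <- moves N) rate a b i.

Lemma total_rate_gt0 : 0 < total_rate.
Proof.
rewrite /total_rate sum_moves; case: N N_gt0 => // n _.
rewrite big_ord_recl ltr_wpDr//; last by rewrite addr_gt0// rate_gt0.
by apply: sumr_ge0 => k _; rewrite addr_ge0// ltW// rate_gt0.
Qed.

(** Jump chain of the confined process: a row k < N is attempted with probability
    proportional to its rate and the result is cropped.  Cropping the argument as
    well extends the kernel from the box to all diagrams. *)
Definition box_kernel f y : R :=
  \sum_(i <- moves N) rate a b i / total_rate * f (step i (crop y)).

Definition crop_invariant f := forall y, f (crop y) = f y.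

Lemma box_kernel_crop f : crop_invariant (box_kernel f).
Proof. by move=> y; rewrite /box_kernel crop_idem. Qed.

Lemma box_prob_ge0 i : 0 <= rate a b i / total_rate.
Proof. by rewrite divr_ge0 ?ltW ?rate_gt0 ?total_rate_gt0. Qed.

Lemma box_prob_sum : \sum_(i <- moves N) rate a b i / total_rate = 1.
Proof. by rewrite -mulr_suml divff// gt_eqF// total_rate_gt0. Qed.

Lemma box_kernel_increasing f : increasing_rows f -> increasing_rows (box_kernel f).
Proof.
move=> finc y z yz; apply: ler_sum => i _; rewrite ler_wpM2l ?box_prob_ge0//.
exact/finc/step_mono/crop_mono.
Qed.

Lemma box_kernel_ge f (m : R) y : (forall z, m <= f z) -> m <= box_kernel f y.
Proof.
move=> mf; rewrite -[leLHS]mul1r -box_prob_sum mulr_suml.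
by apply: ler_sum => i _; rewrite ler_wpM2l ?box_prob_ge0.
Qed.

Lemma box_kernel_le f (m : R) y : (forall z, f z <= m) -> box_kernel f y <= m.
Proof.
move=> fm; rewrite -[leRHS]mul1r -box_prob_sum mulr_suml.
by apply: ler_sum => i _; rewrite ler_wpM2l ?box_prob_ge0.
Qed.

(** Moves in the rows k >= N do not change the cropped diagram.  For the others,
    crop y is below y, so by monotonicity a step from crop y ends below the same
    step from y. *)
Lemma box_kernel_generator_le f y : young y -> crop_invariant f ->
  increasing_rows f -> total_rate * (box_kernel f y - f y) <= L f y.
Proof.
move=> yy fcrop finc; set m := maxn (len y).+1 N.
have -> : L f y = \sum_(i <- moves N) rate a b i * (f (step i y) - f y).
  rewrite /generator.
  rewrite (@sum_moves_widen _ _ m) ?leq_maxl//; last first.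
    by move=> [s k] /= lk; rewrite step_past_len// subrr mulr0.
  rewrite -(@sum_moves_widen _ N m) ?leq_maxr//.
  by move=> [s k] /= Nk; rewrite -fcrop crop_step_far// fcrop subrr mulr0.
rewrite /box_kernel mulrBr mulr_sumr mulr_suml -sumrB.
apply: ler_sum => i _; rewrite mulrA [total_rate * _]mulrC divfK; last first.
  by rewrite gt_eqF// total_rate_gt0.
rewrite -mulrBr ler_pM2l ?rate_gt0// lerD2r.
exact/finc/step_mono/crop_le.
Qed.
End Box.
End Chain.

(** * The Poisson mixture as a subsolution *)

(** Summation by parts; the last term is the flux of Poisson mass out of {0, ..., r-1}. *)
Lemma sum_dweight {R : realType} (r : nat) (s : R) (x : nat -> R) :
  \sum_(n < r) dweight n s * x n =
  \sum_(n < r) weight n s * (x n.+1 - x n) -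
    (if r is m.+1 then weight m s * x r else 0).
Proof.
elim: r => [|r IH]; first by rewrite !big_ord0 subr0.
rewrite !big_ord_recr /= IH /dweight; case: r {IH} => [|r].
  by rewrite !big_ord0; ring.
by ring.
Qed.

Section LowerBound.
Context {R : realType}.
Variables a b : nat -> R.
Hypotheses (a_gt0 : forall k, 0 < a k) (b_gt0 : forall k, 0 < b k).
Variables (A : R) (a_le : forall k, a k <= A).
Implicit Types (f : (nat -> nat) -> R) (y z : nat -> nat).
Local Notation L := (generator (fun y => moves (len y).+1) (rate a b) step).

Variables (N H : nat) (N_gt0 : (0 < N)%N).
Local Notation c := (total_rate a b N).
Local Notation crop := (crop N H).

Variables (u0 : (nat -> nat) -> R).
Hypotheses (u0_crop : crop_invariant N H u0) (u0_incr : increasing_rows u0)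
  (u0_01 : forall y, 0 <= u0 y <= 1).

Definition box_iter (n : nat) : (nat -> nat) -> R := iter n (box_kernel a b N H) u0.
Local Notation u := box_iter.

Lemma box_iter_increasing n : increasing_rows (u n).
Proof. by elim: n => [//|n IH]; exact: box_kernel_increasing. Qed.

Lemma box_iter_crop n : crop_invariant N H (u n).
Proof. by case: n => [//|n]; exact: box_kernel_crop. Qed.

Lemma box_iter_01 n y : 0 <= u n y <= 1.
Proof.
elim: n y => [//|n IH] y; rewrite box_kernel_ge ?box_kernel_le//.
  by move=> z; case/andP: (IH z).
by move=> z; case/andP: (IH z).
Qed.

(** The empty diagram is the smallest one and the iterates are increasing, so this
    is their minimum. *)
Definition box_min (n : nat) : R := u n (fun=> 0%N).

Lemma box_min_le n y : box_min n <= u n y.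
Proof. exact: box_iter_increasing. Qed.

Variables (v : R -> (nat -> nat) -> R).
Hypotheses (v_ge0 : forall (t : R) y, 0 <= t -> young y -> 0 <= v t y)
  (v_start : forall y, young y -> u0 y <= v 0 y)
  (v_growth : forall y (eps : R), young y -> 0 < eps -> exists2 h0 : R, 0 < h0 &
     forall t h : R, 0 <= t -> 0 < h -> h < h0 ->
       v t y + h * (L (v t) y - eps) <= v (t + h) y).

Section Mixture.
Variable r : nat.

(** Equal to sum_(n < r) w_n u_n + (1 - sum_(n < r) w_n) box_min r, with w_n the Poisson
    weights of parameter c t. *)
Definition mixture (t : R) y : R :=
  box_min r + \sum_(n < r) weight n (c * t) * (u n y - box_min r).

Lemma dev_le1 n y : `|u n y - box_min r| <= 1.
Proof.
by rewrite ler_norml /box_min; have := box_iter_01 n y;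
  have := box_iter_01 r (fun=> 0%N); lra.
Qed.

Lemma mixture_bounded t y : 0 <= t -> mixture t y <= r.+1%:R.
Proof.
move=> t0; have ct0 : 0 <= c * t by rewrite mulr_ge0// ltW// total_rate_gt0.
rewrite -natr1 /mixture addrC; apply: lerD; last first.
  by rewrite /box_min; case/andP: (box_iter_01 r (fun=> 0%N)).
apply: (@le_trans _ _ (\sum_(n < r) 1)); last by rewrite sumr_const card_ord.
apply: ler_sum => n _; apply: (le_trans (ler_norm _)).
by rewrite normrM ger0_norm ?weight_ge0// mulr_ile1 ?weight_ge0 ?weight_le1 ?dev_le1.
Qed.

Lemma mixture_start y : (0 < r)%N -> mixture 0 y = u0 y.
Proof.
rewrite /mixture; case: r => // m _; rewrite big_ord_recl mulr0 weight_start mul1r big1.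
  by rewrite addr0 addrC subrK.
by move=> n _; rewrite weight_start mul0r.
Qed.

(** Since L (u n) is at least c (u (n+1) - u n), summation by parts leaves the time
    derivative of the mixture plus a flux term proportional to u r - box_min r,
    which is nonnegative: this is why the remaining mass sits on the minimum. *)
Lemma mixture_generator t y : young y -> 0 <= t ->
  c * \sum_(n < r) dweight n (c * t) * (u n y - box_min r) <= L (mixture t) y.
Proof.
move=> yy t0; have c0 : 0 < c := total_rate_gt0 a_gt0 b_gt0 N_gt0.
have ct0 : 0 <= c * t by rewrite mulr_ge0// ltW.
rewrite (sum_dweight r (c * t) (fun n => u n y - box_min r)).
apply: (@le_trans _ _ (\sum_(n < r) weight n (c * t) * (c * (u n.+1 y - u n y)))).
  rewrite mulrBr mulr_sumr; apply: (@le_trans _ _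
      (\sum_(n < r) c * (weight n (c * t) * (u n.+1 y - box_min r - (u n y - box_min r))))).
    rewrite lerBlDr lerDl mulr_ge0 ?(ltW c0)//; case: r => // m.
    by rewrite mulr_ge0 ?weight_ge0// subr_ge0 box_min_le.
  by apply: ler_sum => n _; rewrite le_eqVlt; apply/orP; left; apply/eqP; ring.
have -> : L (mixture t) y = \sum_(n < r) weight n (c * t) * L (u n) y.
  rewrite /generator; under [RHS]eq_bigr do rewrite mulr_sumr.
  rewrite exchange_big /=; apply: eq_bigr => i _.
  rewrite /mixture opprD addrACA subrr add0r -sumrB mulr_sumr.
  by apply: eq_bigr => n _; ring.
apply: ler_sum => n _; rewrite ler_wpM2l ?weight_ge0//.
apply: box_kernel_generator_le => //; [exact: box_iter_crop|exact: box_iter_increasing].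
Qed.

Lemma mixture_increment t h y : 0 <= t -> 0 <= h ->
  mixture (t + h) y <= mixture t y
    + h * (c * \sum_(n < r) dweight n (c * t) * (u n y - box_min r))
    + 2 * r%:R * (c * h) ^+ 2.
Proof.
move=> t0 h0; have c0 : 0 <= c := ltW (total_rate_gt0 a_gt0 b_gt0 N_gt0).
have ct0 : 0 <= c * t by rewrite mulr_ge0.
have ch0 : 0 <= c * h by rewrite mulr_ge0.
rewrite -!addrA lerD2l -lerBlDl -sumrB mulrA [h * c]mulrC mulr_sumr -lerBlDl -sumrB.
apply: (@le_trans _ _ (\sum_(n < r) 2 * (c * h) ^+ 2)); last first.
  by rewrite sumr_const card_ord -[_ *+ r]mulr_natr mulrAC.
apply: ler_sum => n _; rewrite mulrA -!mulrBl (mulrDr c t h).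
apply: (le_trans (ler_norm _)); rewrite normrM.
rewrite -[leRHS]mulr1; apply: ler_pM => //; last exact: dev_le1.
exact: weight_increment.
Qed.

Lemma mixture_le t y : (0 < r)%N -> 0 <= t -> young y -> mixture t y <= v t y.
Proof.
move=> r0 t0 yy; rewrite -subr_ge0; move: t y t0 yy.
pose U t y := v t y - mixture t y; rewrite -/(U _ _).
have A0 : 0 <= A := le_trans (ltW (a_gt0 0%N)) (a_le 0%N).
apply: (@minimum_principle R _ _ young (fun y => moves (len y).+1) (rate a b) step
  _ _ (barrier (R := R)) (2 * A) _ _ _ _ U r.+1%:R).
- by move=> i; apply/ltW/rate_gt0.
- by move=> i y; exact: step_young.
- by move=> y _; rewrite /barrier.
- by move=> y; exact: barrier_generator_le.
- by rewrite mulr_ge0.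
- exact: barrier_proper.
- by move=> t y t0 yy; have := mixture_bounded y t0; have := v_ge0 t0 yy; rewrite /U; lra.
- by move=> y yy; rewrite /U mixture_start// subr_ge0 v_start.
move=> y eps yy eps0; have e2 : 0 < eps / 2 by rewrite divr_gt0.
have [h1 h10 H1] := v_growth yy e2.
have c0 : 0 < c := total_rate_gt0 a_gt0 b_gt0 N_gt0.
pose B := 2 * r%:R * c ^+ 2 + 1.
have B0 : 0 < B by rewrite ltr_wpDl// !mulr_ge0 ?exprn_ge0// ltW.
(* half of eps goes to v, the other half to the second-order term of the mixture *)
exists (Num.min h1 (eps / 2 / B)); first by rewrite lt_min h10 divr_gt0.
move=> t h t0 h0; rewrite lt_min => /andP[hh1]; rewrite ltr_pdivlMr// => hB.
have := H1 t h t0 h0 hh1.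
have := mixture_increment y t0 (ltW h0).
have := mixture_generator yy t0; rewrite -(ler_pM2l h0).
have -> : L (U t) y = L (v t) y - L (mixture t) y.
  by rewrite /generator -sumrB; apply: eq_bigr => i _; rewrite /U; ring.
have quad : 2 * r%:R * (c * h) ^+ 2 <= h * (eps / 2).
  apply: (@le_trans _ _ (h * (h * B))); last by rewrite ler_pM2l// ltW.
  have hh : 0 <= h * h by rewrite mulr_ge0// ltW.
  by rewrite /B; lra.
by rewrite /U; lra.
Qed.

Lemma mixture_limit (eps : R) : 0 < eps -> exists2 t0, 0 < t0 & forall t y,
  t0 <= t -> box_min r - eps <= mixture t y.
Proof.
move=> eps0; have c0 : 0 < c := total_rate_gt0 a_gt0 b_gt0 N_gt0.
have e0 : 0 < eps / r.+1%:R by rewrite divr_gt0// ltr0n.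
have [s0 s00 Hs] : exists2 s0 : R, 0 < s0 & forall s n, s0 <= s -> (n < r)%N ->
    weight n s <= eps / r.+1%:R.
  move: (eps / r.+1%:R) e0 => e e0; elim: r => [|m [s1 s10 H1]]; first by exists 1.
  have [s2 s20 H2] := weight_decay m e0.
  exists (Num.max s1 s2); first by rewrite lt_max s10.
  move=> s n; rewrite ge_max => /andP[ss1 ss2]; rewrite ltnS leq_eqVlt.
  by move=> /orP[/eqP ->|]; [exact: H2|exact: H1].
exists (s0 / c); first by rewrite divr_gt0.
move=> t y; rewrite ler_pdivrMr// mulrC => st; rewrite /mixture lerD2l.
rewrite lerNl -sumrN; apply: (@le_trans _ _ (\sum_(n < r) eps / r.+1%:R)).
  apply: ler_sum => n _; apply: (le_trans (ler_norm _)).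
  rewrite normrN normrM ger0_norm ?weight_ge0 ?(le_trans (ltW s00) st)//.
  rewrite -[leRHS]mulr1; apply: ler_pM => //; last exact: dev_le1.
    by rewrite weight_ge0// (le_trans (ltW s00) st).
  exact: Hs.
rewrite sumr_const card_ord -[_ *+ r]mulr_natr mulrAC ler_pdivrMr ?ltr0n//.
by rewrite ler_pM2l// ler_nat.
Qed.
End Mixture.

Lemma eventually_ge_box_min n (eps : R) : 0 < eps ->
  exists2 t0, 0 < t0 & forall t y, t0 <= t -> young y -> box_min n.+1 - eps <= v t y.
Proof.
move=> eps0; have [t0 t00 Ht] := mixture_limit n.+1 eps0; exists t0 => // t y tt0 yy.
by apply: le_trans (Ht t y tt0) (mixture_le _ _ _) => //; exact: le_trans (ltW t00) tt0.
Qed.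
End LowerBound.

(** * Reversibility and irreducibility of the confined chain *)

Section Reversible.
Context {R : realType}.
Variables a b : nat -> R.
Hypotheses (a_gt0 : forall k, 0 < a k) (b_gt0 : forall k, 0 < b k).
Implicit Types (f : (nat -> nat) -> R) (y z : nat -> nat).

Definition box (N H : nat) : set (nat -> nat) :=
  [set y | [/\ young y, (y 0%N <= H)%N & y N = 0%N]].

Lemma box_le N H y k : box N H y -> (y k <= H)%N.
Proof. by move=> [yy y0 _]; apply: leq_trans y0; exact: young_nonincreasing. Qed.

Lemma box_out N H y k : box N H y -> (N <= k)%N -> y k = 0%N.
Proof.
move=> [yy _ yN] Nk; apply/eqP; rewrite -leqn0 -[X in (_ <= X)%N]yN.
exact: young_nonincreasing.
Qed.

Lemma crop_box N H y : box N H y -> crop N H y = y.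
Proof.
move=> By; apply/funext => k; rewrite /crop; have := box_le k By.
by case: ltnP => [_|/(box_out By)]; lia.
Qed.

Lemma box_finite N H : finite_set (box N H).
Proof.
apply: (sub_finite_set _ (bounded_rows_finite N H)) => y By.
by split=> k; [exact: box_le By|exact: box_out By].
Qed.

Definition rev_weight (N : nat) y : R := \prod_(k < N) (a k / b k) ^+ y k.

Lemma rev_weight_gt0 N y : 0 < rev_weight N y.
Proof. by apply: prodr_gt0 => k _; rewrite exprn_gt0// divr_gt0. Qed.

Lemma rev_weight_step N y k : (k < N)%N -> addable y k ->
  rev_weight N (step (true, k) y) * b k = rev_weight N y * a k.
Proof.
move=> kN yk; rewrite /rev_weight (bigD1 (Ordinal kN))//= [in RHS](bigD1 (Ordinal kN))//=.
rewrite /step /= yk eqxx addn1 exprS.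
rewrite [X in _ * X * b k](eq_bigr (fun i : 'I_N => (a i / b i) ^+ y i)); last first.
  by move=> i /negbTE ik; rewrite [_ == _]ik addn0.
by field; rewrite gt_eqF.
Qed.

Lemma addable_down z k : young z -> removable z k -> addable (step (false, k) z) k.
Proof.
move=> zz zk; rewrite /addable /step /= zk; case: (eqVneq k 0%N) => //= k0.
have -> : (k.-1 == k) = false by lia.
rewrite eqxx /= subn0; move: zk; rewrite /removable => zk.
by have := young_nonincreasing zz (leq_pred k); lia.
Qed.

Lemma step_up_down z k : young z -> removable z k ->
  step (true, k) (step (false, k) z) = z.
Proof.
move=> zz zk; apply/funext => j; rewrite {1}/step /= addable_down// andbT.
by move: zk; rewrite /step /= /removable; case: eqVneq => [->|_] zk; rewrite ?zk; lia.
Qed.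

Lemma step_down_up y k : young y -> addable y k ->
  step (false, k) (step (true, k) y) = y.
Proof.
move=> yy yk; have yk' : removable (step (true, k) y) k.
  by rewrite /removable /step /= yk eqxx; case: yy => /(_ k); lia.
by apply/funext => j; rewrite {1}/step /= yk' /step /= yk; lia.
Qed.

(** Growing and shrinking row k are mutually inverse moves inside the box. *)
Lemma step_up_box_bij N H k : (k < N)%N ->
  set_bij (box N H `&` [set y | addable y k && (y k < H)%N])
          (box N H `&` [set z | removable z k]) (step (true, k)).
Proof.
move=> kN; split.
- move=> y [By /= /andP[yk kH]]; have [yy y0 yN] := By; split; last first.
    rewrite /= /removable /step /= yk eqxx; case: yy => /(_ k); lia.
  split; first exact: step_young.
    by rewrite /step /= yk andbT; case: eqVneq => [E|_]; [rewrite -E in kH; lia|lia].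
  by rewrite /step /= yN; lia.
- move=> y z; rewrite !inE => -[_ /= /andP[yk _]] [_ /= /andP[zk _]] E.
  apply/funext => j; have := congr1 (fun x => x j) E.
  by rewrite /step /= yk zk; lia.
- move=> z [Bz /= zk]; have [zz z0 zN] := Bz.
  have zkH := box_le k Bz.
  exists (step (false, k) z); last exact: step_up_down.
  split; last first.
    rewrite /= addable_down// /step /= zk eqxx.
    by move: zk; rewrite /removable; lia.
  split; [exact: step_young| |]; rewrite /step /=; lia.
Qed.

Variables (N H : nat) (N_gt0 : (0 < N)%N).
Local Notation E := (box N H).
Local Notation pi := (rev_weight N).

(** Detailed balance between y and y plus a cell in row k:
    weight(y) a_k = weight(y + cell) b_k; the blocked moves contribute 0. *)
Lemma detailed_balance_row f k : crop_invariant N H f -> (k < N)%N ->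
  \sum_(y \in E) pi y * (a k * (f (step (true, k) y) - f y)) +
  \sum_(y \in E) pi y * (b k * (f (step (false, k) y) - f y)) = 0.
Proof.
move=> fcrop kN.
rewrite -(@fsbig_widen _ _ _ _ (E `&` [set y | addable y k && (y k < H)%N])); last 2 first.
- exact: subIsetl.
- move=> y [By /= ynot]; suff -> : f (step (true, k) y) = f y by rewrite subrr !mulr0.
  rewrite -fcrop -[in RHS]fcrop; congr f; apply/funext => j; rewrite /crop.
  case: ltnP => // jN; rewrite /step /=; have := box_le k By.
  case: eqVneq => [->|_]; last by rewrite addn0.
  case yk : (addable y k); last by rewrite addn0.
  have : ~~ (y k < H)%N by apply/negP => ykH; apply: ynot; split=> //=; rewrite yk.
  by lia.
rewrite -[X in _ + X](@fsbig_widen _ _ _ _ (E `&` [set z | removable z k])); last 2 first.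
- exact: subIsetl.
- move=> y [By /= ynot]; have yk : ~~ removable y k by apply/negP => ?; exact: ynot.
  by rewrite (@step_blocked (false, k))// subrr !mulr0.
rewrite (reindex_fsbig _ _ _ _ (step_up_box_bij H kN)) -fsbig_split/=; last first.
  exact/finite_setIl/box_finite.
apply: fsbig1 => y [By /= /andP[yk _]]; have [yy _ _] := By.
rewrite step_down_up// [X in _ + X]mulrA rev_weight_step//.
by move: (f y) (f _) => u w; ring.
Qed.

Lemma box_kernel_stationary f : crop_invariant N H f ->
  \sum_(y \in E) pi y * box_kernel a b N H f y = \sum_(y \in E) pi y * f y.
Proof.
move=> fcrop; have c0 := total_rate_gt0 a_gt0 b_gt0 N_gt0.
apply/eqP; rewrite -subr_eq0 -(mulrI_eq0 _ (lregP (lt0r_neq0 c0))); apply/eqP.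
have finE := box_finite N H.
rewrite !fsbig_finite//= -sumrB mulr_sumr.
transitivity (\sum_(y <- finmap.enum_fset (fset_set E)) \sum_(k < N)
  (pi y * (a k * (f (step (true, k : nat) y) - f y)) +
   pi y * (b k * (f (step (false, k : nat) y) - f y)))).
  rewrite !big_seq; apply: eq_bigr => y; rewrite in_fset_set// inE => By.
  rewrite -mulrBr mulrCA; under [RHS]eq_bigr do rewrite -mulrDr.
  rewrite -mulr_sumr; congr (_ * _).
  rewrite -(sum_moves N (fun i => rate a b i * (f (step i y) - f y))).
  rewrite /box_kernel (crop_box By) mulrBr mulr_sumr mulr_suml -sumrB.
  apply: eq_bigr => i _; rewrite mulrA [total_rate _ _ _ * _]mulrC divfK ?gt_eqF//.
  by rewrite mulrBr.
rewrite exchange_big /= big1// => k _; rewrite big_split /=.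
rewrite -!fsbig_finite//=.
exact: detailed_balance_row.
Qed.

(** Irreducibility, in the form used below: from the empty diagram, y is reached in j
    steps with probability at least delta, by adding its cells one at a time. *)
Lemma box_path y : E y -> exists j delta, 0 < delta /\
  forall f (m : R), (forall z, m <= f z) ->
    m + delta * (f y - m) <= iter j (box_kernel a b N H) f (fun=> 0%N).
Proof.
elim: {y}_.+1 {-2}y (ltnSn (\sum_(k < N) y k)%N) => // n IH y yn By.
have [yy _ yN] := By; have [y0|ypos] := posnP (len y).
  exists 0%N, 1; split=> // f m _ /=; rewrite mul1r addrC subrK le_eqVlt.
  apply/orP; left; apply/eqP; congr f; apply/funext => k.
  by apply: len0 => //; rewrite y0.
pose k := (len y).-1.
have yk : (0 < y k)%N by rewrite lt0n lenP// /k; lia.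
have yk1 : removable y k.
  by rewrite /removable (@len0 y k.+1)// /k prednK.
have kN : (k < N)%N by have := len_le yy yN; rewrite /k; lia.
pose y' := step (false, k) y.
have By' : E y'.
  by have [? y0 ?] := By; split; [exact: step_young| |]; rewrite /y' /step /=; lia.
have y'n : (\sum_(k < N) y' k < n)%N.
  rewrite -ltnS; apply: leq_trans yn; rewrite ltnS.
  rewrite (bigD1 (Ordinal kN))//= [in leqRHS](bigD1 (Ordinal kN))//=.
  rewrite -addSn; apply: leq_add; first by rewrite /y' /step /= yk1 eqxx; lia.
  by apply: leq_sum => i _; rewrite /y' /step /=; lia.
have [j [delta [delta0 Hj]]] := IH y' y'n By'.
pose p := rate a b (true, k) / total_rate a b N.
have p0 : 0 < p by rewrite divr_gt0 ?total_rate_gt0 ?rate_gt0.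
exists j.+1, (delta * p); split; first exact: mulr_gt0.
move=> f m mf; rewrite iterSr.
apply: le_trans (Hj _ m _); last by move=> z; exact: box_kernel_ge.
rewrite lerD2l -mulrA ler_pM2l// -[m in leRHS]mul1r -(box_prob_sum a_gt0 b_gt0 N_gt0).
rewrite /box_kernel mulr_suml -sumrB (crop_box By').
rewrite (bigD1_seq (true, k)) ?mem_moves ?moves_uniq//= -mulrBr.
rewrite step_up_down// lerDl; apply: sumr_ge0 => i _.
by rewrite -mulrBr mulr_ge0 ?box_prob_ge0// subr_ge0.
Qed.
End Reversible.

(** * Counting columns *)

Section ColumnCount.
Context {R : realType}.
Variables a b : nat -> R.
Hypotheses (a_gt0 : forall k, 0 < a k) (b_gt0 : forall k, 0 < b k).
Implicit Types (f : (nat -> nat) -> R) (y z : nat -> nat).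

Definition box_mass (N H : nat) : R := \sum_(y \in box N H) rev_weight a b N y.

Definition add_column (k : nat) y : nat -> nat := fun j => (y j + (j <= k))%N.

(** A column of height k + 1 can be inserted into any diagram, and it can be removed
    exactly when the rows k and k + 1 differ in length. *)
Lemma add_column_bij N H k : (k < N)%N ->
  set_bij (box N H) (box N H.+1 `&` [set z | removable z k]) (add_column k).
Proof.
move=> kN; split.
- move=> y By; have [yy y0 yN] := By; split; last first.
    by rewrite /= /removable /add_column leqnn; case: yy => /(_ k); lia.
  split; last 2 first.
  + by rewrite /add_column; lia.
  + by rewrite /add_column yN; lia.
  split; first by move=> j; rewrite /add_column; case: yy => /(_ j); lia.
  by exists N => j Nj; rewrite /add_column (box_out By)//; lia.
- move=> y z _ _ E; apply/funext => j; have := congr1 (fun x => x j) E.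
  by rewrite /add_column; lia.
- move=> z [Bz /= zk]; have [zz z0 zN] := Bz.
  have zpos j : (j <= k)%N -> (0 < z j)%N.
    by move=> /(young_nonincreasing zz); move: zk; rewrite /removable; lia.
  exists (fun j => (z j - (j <= k))%N); last first.
    by apply/funext => j; rewrite /add_column; have := zpos j; lia.
  split; last 2 first.
  + by lia.
  + by rewrite zN.
  split; last by exists N => j Nj; rewrite (box_out Bz).
  move=> j; have [jk|kj] := ltnP j k.
    by case: zz => /(_ j); have := zpos j; have := zpos j.+1; lia.
  have [jk|jk] := eqVneq j k; last by case: zz => /(_ j); lia.
  by rewrite jk; move: zk; rewrite /removable; lia.
Qed.

Lemma rev_weight_add_column N k y : (k < N)%N ->
  rev_weight a b N (add_column k y) = alpha a b k.+1 * rev_weight a b N y.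
Proof.
move=> kN; rewrite /rev_weight /add_column.
under eq_bigr do rewrite exprD; rewrite big_split /= mulrC; congr (_ * _).
rewrite /alpha -prodf_div !big_mkord (big_ord_widen N (fun i => a i / b i))// [RHS]big_mkcond.
by apply: eq_bigr => i _; rewrite ltnS; case: leqP.
Qed.

(** Each corner of the diagram takes up at least one column. *)
Lemma sum_removable_le N z : young z -> (\sum_(k < N) removable z k <= z 0)%N.
Proof.
move=> zz; suff : (\sum_(k < N) removable z k + z N <= z 0)%N by lia.
elim: N => [|N IH]; first by rewrite big_ord0.
rewrite big_ord_recr /=; apply: leq_trans IH; rewrite -addnA leq_add2l.
by rewrite /removable; case: zz => /(_ N); lia.
Qed.

(** Sum the identity alpha_(k+1) weight(y) = weight(y + column) over y and k < N; a
    diagram z is counted once for each of its corners, hence at most z_0 <= H + 1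
    times. *)
Lemma box_mass_column N H :
  (\sum_(k < N) alpha a b k.+1) * box_mass N H <= H.+1%:R * box_mass N H.+1.
Proof.
have finE h := box_finite N h.
rewrite mulr_suml.
have -> : \sum_(k < N) alpha a b k.+1 * box_mass N H =
  \sum_(k < N) \sum_(z \in box N H.+1) rev_weight a b N z * (removable z k)%:R.
  apply: eq_bigr => k _; rewrite /box_mass mulr_fsumr.
  rewrite -[RHS](@fsbig_widen _ _ _ _ (box N H.+1 `&` [set z | removable z k])); last 2 first.
  - exact: subIsetl.
  - move=> z [Bz /= nz]; have /negbTE -> : ~~ removable z k by apply/negP => ?; exact: nz.
    by rewrite mulr0.
  rewrite (reindex_fsbig _ _ _ _ (add_column_bij H (ltn_ord k))).
  apply: eq_fsbigr => y; rewrite inE => By; rewrite rev_weight_add_column//.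
  have [_ /=] : (box N H.+1 `&` [set z | removable z k]) (add_column k y).
    by case: (add_column_bij H (ltn_ord k)) => sub _ _; exact: sub.
  by move=> ->; rewrite mulr1.
rewrite /box_mass mulr_fsumr !fsbig_finite//=.
under eq_bigr do rewrite fsbig_finite//=.
rewrite exchange_big /= !big_seq; apply: ler_sum => z.
rewrite in_fset_set// inE => Bz; have [zz z0 _] := Bz.
rewrite -mulr_sumr mulrC ler_pM2r ?rev_weight_gt0//.
rewrite -natr_sum ler_nat; exact: leq_trans (sum_removable_le N zz) z0.
Qed.

Lemma box_mass_gt0 N H : 0 < box_mass N H.
Proof.
rewrite /box_mass fsbig_finite; last exact: box_finite.
have B0 : box N H (fun=> 0%N) by split=> //; split=> //; exists 0%N.
rewrite (bigD1_seq (fun=> 0%N))/= ?finmap.fset_uniq//; last first.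
  by rewrite in_fset_set ?inE//; exact: box_finite.
rewrite ltr_wpDr ?rev_weight_gt0//; apply: sumr_ge0 => y _.
exact/ltW/rev_weight_gt0.
Qed.

Definition long_first_row (N m : nat) y : R := (m < crop N m.+1 y 0)%:R.

Lemma long_first_row_crop N m : crop_invariant N m.+1 (long_first_row N m).
Proof. by move=> y; rewrite /long_first_row crop_idem. Qed.

Lemma long_first_row_increasing N m : increasing_rows (long_first_row N m).
Proof.
move=> y z yz; rewrite /long_first_row ler_nat.
by have := crop_mono N m.+1 yz 0%N; case: ltnP => // my mz; rewrite (leq_trans my).
Qed.

Lemma long_first_row_01 N m y : 0 <= long_first_row N m y <= 1.
Proof. by rewrite /long_first_row ler0n lern1 leq_b1. Qed.

Lemma long_first_row_mean N m :
  \sum_(y \in box N m.+1) rev_weight a b N y * long_first_row N m y =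
  box_mass N m.+1 - box_mass N m.
Proof.
have finE h := box_finite N h.
have sub : box N m `<=` box N m.+1 by move=> y [yy y0 yN]; split => //; lia.
rewrite /box_mass [in X in _ = X - _](fsbigID (box N m))//.
rewrite (_ : box N m.+1 `&` box N m = box N m); last first.
  by apply/seteqP; split=> [y []//|y By]; split => //; exact: sub.
rewrite addrC addKr.
rewrite -[LHS](@fsbig_widen _ _ _ _ (box N m.+1 `&` ~` box N m)); last 2 first.
- exact: subIsetl.
- move=> y [By /= nB]; have Bm : box N m y.
    by apply: contrapT => nb; apply: nB.
  rewrite /long_first_row (crop_box By); have [_ y0 _] := Bm.
  by rewrite ltnNge y0 mulr0.
apply: eq_fsbigr => y; rewrite inE => -[By /= nB].
rewrite /long_first_row (crop_box By); have [yy y0 yN] := By.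
suff -> : (m < y 0)%N by rewrite mulr1.
by rewrite ltnNge; apply/negP => ?; apply: nB.
Qed.

(** Convergence to equilibrium without spectral theory.  The iterates have constant
    mean, so their value at the full box, their maximum, is at least that mean and
    hence at least gam.  If all the minima stayed below gam - eps, every passage
    of length j from the empty diagram to the full box would raise the minimum
    by delta eps, and the minima would exceed 1. *)
Lemma box_min_limit N m (eps : R) : (0 < N)%N -> 0 < eps -> exists n,
  1 - m.+1%:R / (\sum_(k < N) alpha a b k.+1) - eps <=
  box_min a b N m.+1 (long_first_row N m) n.+1.
Proof.
move=> N0 eps0; set u0 := long_first_row N m; set gam := 1 - _.
pose u := box_iter a b N m.+1 u0.
have uincr n : increasing_rows (u n).
  by apply: box_iter_increasing => //; exact: long_first_row_increasing.
have ucrop n : crop_invariant N m.+1 (u n).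
  by apply: box_iter_crop; exact: long_first_row_crop.
have u01 n y : 0 <= u n y <= 1.
  by apply: box_iter_01 => //; exact: long_first_row_01.
have Z0 := box_mass_gt0 N m.+1.
have mean n : \sum_(y \in box N m.+1) rev_weight a b N y * u n y =
    box_mass N m.+1 - box_mass N m.
  elim: n => [|n IH]; first exact: long_first_row_mean.
  by rewrite -IH; exact: box_kernel_stationary.
pose full : nat -> nat := fun k => if (k < N)%N then m.+1 else 0%N.
have Bfull : box N m.+1 full.
  split; [split|by rewrite /full; case: ifP|by rewrite /full ltnn].
    by move=> k; rewrite /full; case: (ltnP k.+1 N) => //; case: (ltnP k N) => //; lia.
  by exists N => k Nk; rewrite /full ltnNge Nk.
have ufull n : gam <= u n full.
  have alpha0 : 0 < \sum_(k < N) alpha a b k.+1.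
    have al k : 0 < alpha a b k by rewrite /alpha divr_gt0// prodr_gt0.
    case: (N) N0 => // N' _; rewrite big_ord_recl ltr_wpDr//.
    by apply: sumr_ge0 => k _; exact: ltW.
  have Zle : box_mass N m / box_mass N m.+1 <= m.+1%:R / (\sum_(k < N) alpha a b k.+1).
    rewrite ler_pdivrMr// mulrAC ler_pdivlMr// mulrC; exact: box_mass_column.
  apply: (@le_trans _ _ ((box_mass N m.+1 - box_mass N m) / box_mass N m.+1)).
    by rewrite mulrBl divff ?gt_eqF// /gam; lra.
  rewrite ler_pdivrMr// -(mean n) /box_mass mulr_fsumr.
  rewrite !fsbig_finite ?box_finite//=; last 2 first.
    exact: box_finite. exact: box_finite.
  rewrite !big_seq; apply: ler_sum => y.
  rewrite in_fset_set; last exact: box_finite.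
  rewrite inE => By; rewrite mulrC ler_pM2r ?rev_weight_gt0//; apply: uincr => k.
  rewrite /full; case: ltnP => [_|Nk]; first exact: box_le By.
  by rewrite (box_out By).
have [j [delta [delta0 Hj]]] := box_path a_gt0 b_gt0 N0 Bfull.
apply: contrapT => /forallNP nope.
have low n : u n.+1 (fun=> 0%N) < gam - eps.
  by rewrite ltNge; apply/negP => H; apply: (nope n).
(* one passage from the empty diagram to the full box *)
have jump n : u n.+1 (fun=> 0%N) + delta * eps <= u (j + n.+1)%N (fun=> 0%N).
  have bottom z : u n.+1 (fun=> 0%N) <= u n.+1 z by exact: uincr.
  rewrite /u /box_iter iterD; apply: le_trans (Hj _ _ bottom).
  rewrite lerD2l ler_pM2l//; have := low n; have := ufull n.+1.
  by rewrite /u /box_iter; lra.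
have climb i : i%:R * (delta * eps) <= u (i * j).+1 (fun=> 0%N).
  elim: i => [|i IH]; first by rewrite mul0r; case/andP: (u01 1%N (fun=> 0%N)).
  rewrite -natr1 mulrDl mul1r mulSn -addnS.
  by apply: le_trans (jump (i * j)%N); rewrite lerD2r.
have de0 : 0 < delta * eps by exact: mulr_gt0.
have := climb (Num.trunc (delta * eps)^-1).+1.
rewrite leNgt => /negP; apply.
apply: (@le_lt_trans _ _ 1).
  by case/andP: (u01 ((Num.trunc (delta * eps)^-1).+1 * j).+1 (fun=> 0%N)).
by rewrite -ltr_pdivrMr// div1r truncnS_gt.
Qed.
End ColumnCount.

(** * Escape of the leftmost particle from a fixed start *)

Section ExclusionMass.
Context {R : realType}.
Variables a b : nat -> R.
Hypotheses (a_gt0 : forall k, 0 < a k) (b_gt0 : forall k, 0 < b k).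
Variables (A : R) (a_le : forall k, a k <= A).
Variable p : R -> (nat -> int) -> (nat -> int) -> R.
Local Notation S := (@finite_configuration).
Hypotheses (tf : transition_function S p) (hr : has_rates S (exclusion_rates a b) p).
Local Notation L := (generator (fun y => moves (len y).+1) (rate a b) step).

Lemma exclusion_mass_growth B c y (eps : R) : young y -> 0 < eps ->
  let v t z := mass S p B t (particles c z) in
  exists2 h0 : R, 0 < h0 & forall t h : R, 0 <= t -> 0 < h -> h < h0 ->
    v t y + h * (L (v t) y - eps) <= v (t + h) y.
Proof.
move=> yy eps0 v.
pose I := [seq i <- moves (len y).+1 | allowed i y].
have allI i : i \in I -> allowed i y by rewrite mem_filter => /andP[].
have neq i : i \in I -> particles c (step i y) != particles c y.
  by move=> /allI yi; apply/eqP => /particles_inj; exact: step_allowed_neq.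
have [|||||h0 h00 H0] := @mass_backward R _ S (exclusion_rates a b) p tf hr _ B I
    (fun i => particles c (step i y)) (rate a b) (particles c y) eps
    (particles_finite_configuration c yy) _ neq _ _ _ _ eps0.
- by move=> i _; exact/particles_finite_configuration/step_young.
- exact/filter_uniq/moves_uniq.
- by move=> i j /allI yi /allI yj /particles_inj; exact: step_inj.
- move=> i iI; rewrite /exclusion_rates eq_sym (negbTE (neq _ iI)).
  by rewrite jump_rateE//; exact: allI.
- by rewrite /exclusion_rates eqxx exit_rateE// big_filter.
exists h0 => // t h t0 hgt0 hlt; rewrite /v; apply: le_trans (H0 t h t0 hgt0 hlt).
rewrite lerD2l ler_pM2l// lerD2r big_filter [leRHS]big_mkcond /generator le_eqVlt.
apply/orP; left; apply/eqP; apply: eq_bigr => i _; case: ifPn => // yi.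
by rewrite step_blocked// subrr mulr0.
Qed.

Lemma mass_time0 (B : set (nat -> int)) x : S x -> B x -> 1 <= mass S p B 0 x.
Proof.
move=> Sx Bx; rewrite -lee_fin (mass_esum tf B (lexx _) Sx).1.
apply: esum_ge; exists [set x]; first by split; [exact: finite_set1|move=> _ ->].
by rewrite fsbig_set1 (tf_time0 tf)// eqxx.
Qed.

Hypothesis (alpha_unbounded : forall C : R, exists n, C < \sum_(k < n) alpha a b k).

(** With x = particles c y, the target x_0 < - M contains the diagrams whose first row
    exceeds m as soon as m > c + M.  The three thirds of eps pay for the
    stationary probability, for the convergence of the iterates and for the
    convergence in time. *)
Lemma leftmost_escapes (M : R) x (eps : R) : S x -> 0 < eps ->
  exists t0, forall t, t0 <= t ->
    1 - eps <= mass S p [set z | (z 0%N)%:~R < - M] t x.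
Proof.
move=> Sx eps0; have [c [y [yy ->]]] := finite_configuration_particles Sx.
set B := [set z | _].
have [m cm] : exists m : nat, c%:~R + M < m%:R :> R.
  exists (Num.trunc (Num.max 0 (c%:~R + M))).+1.
  by rewrite (le_lt_trans _ (truncnS_gt _))// le_max lexx orbT.
have e3 : 0 < eps / 3 by rewrite divr_gt0.
have [N N0 HN] : exists2 N, (0 < N)%N &
    m.+1%:R / (\sum_(k < N) alpha a b k.+1) <= eps / 3.
  have mpos : 0 < m.+1%:R / (eps / 3) :> R by rewrite divr_gt0// ltr0n.
  (* the extra 1 is alpha_0, which no inserted column accounts for *)
  have [[|N] HN] := alpha_unbounded (1 + m.+1%:R / (eps / 3)).
    by move: HN; rewrite big_ord0; lra.
  have Nsum : m.+1%:R / (eps / 3) < \sum_(k < N) alpha a b k.+1.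
    move: HN; rewrite big_ord_recl {1}/alpha !big_geq// divr1.
    by rewrite ltrD2l; under eq_bigr do rewrite /= /bump /=.
  exists N; first by case: N {HN} Nsum => //; rewrite big_ord0; lra.
  rewrite ler_pdivrMr ?(lt_trans mpos)// mulrC -ler_pdivrMr//; exact: ltW.
have [n Hn] := box_min_limit a_gt0 b_gt0 m N0 e3.
pose v t z := mass S p B t (particles c z).
have v0 (t : R) z : 0 <= t -> young z -> 0 <= v t z.
  by move=> t0 zz; apply: (mass_ge0 tf) => //; exact: particles_finite_configuration.
have vstart z : young z -> long_first_row N m z <= v 0 z.
  move=> zz; rewrite /long_first_row; case: ltnP => [mz|_]; last exact: v0.
  apply: mass_time0; first exact: particles_finite_configuration.
  have mz0 : (m < z 0)%N by apply: leq_trans mz (crop_le _ _ _ _).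
  rewrite /B /= /particles addr0 intrB.
  have : m%:R <= (z 0%N)%:R :> R by rewrite ler_nat ltnW.
  rewrite -!pmulrn; lra.
have [t0 t00 Ht0] := @eventually_ge_box_min R a b a_gt0 b_gt0 A a_le N m.+1 N0
  (long_first_row N m) (long_first_row_crop N m) (long_first_row_increasing N m)
  (long_first_row_01 N m) v v0 vstart (fun z e zz e0 => exclusion_mass_growth B c zz e0) n _ e3.
exists t0 => t tt0; apply: le_trans (Ht0 t y tt0 yy).
by move: HN Hn; lra.
Qed.
End ExclusionMass.

(** * From transition probabilities to the process *)

Lemma finite_configuration_enum :
  exists g : nat -> nat -> int, @finite_configuration `<=` range g.
Proof.
exists (fun n => if @unpickle (int * seq nat)%type n is Some cs
          then particles cs.1 (nth 0%N cs.2) else fun=> 0) => x Sx.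
have [c [y [[yd [n yn]] ->]]] := finite_configuration_particles Sx.
exists (pickle (c, mkseq y n)) => //; rewrite pickleK /=; congr particles.
apply/funext => k; have [kn|nk] := ltnP k n; first by rewrite nth_mkseq.
by rewrite nth_default ?size_mkseq// yn.
Qed.

Section Process.
Context {R : realType} {T : choiceType}.
Variables (S : set T) (p : R -> T -> T -> R).
Hypothesis tf : transition_function S p.
Variables (d : measure_display) (Omega : measurableType d) (P : probability Omega R).
Variables (X : R -> Omega -> T) (mp : markov_process S p P X).
Variables (g : nat -> T) (Sg : S `<=` range g).

Lemma event_measurable (B : set T) t : 0 <= t -> measurable [set w | B (X t w)].
Proof.
move=> t0.
rewrite (_ : [set w | _] = \bigcup_(n in [set n | S (g n) /\ B (g n)])
    [set w | X t w = g n]); last first.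
  apply/seteqP; split=> [w /= Bw|w [n /= [_ Bn] ->]//].
  have Sw := mp_state mp w t0; have [n _ gn] := Sg Sw.
  by exists n => /=; rewrite gn.
by apply: bigcup_measurable => n [Sn _]; exact: mp_measurable mp _ _ t0 Sn.
Qed.

(** The Markov property at time 0 with an empty past. *)
Lemma two_time_law t x y : 0 <= t -> S x -> S y ->
  P [set w | X 0 w = x /\ X t w = y] = (P [set w | X 0 w = x] * (p t x y)%:E)%E.
Proof.
move=> t0 Sx Sy.
have := @mp_markov _ _ _ _ _ _ _ _ mp 0%N (fun=> 0) (fun=> x) 0 t x y.
rewrite add0r => /(_ _ t0 (lexx _) Sx Sy).
rewrite (_ : [set w | [/\ _, _ & _]] = [set w | X 0 w = x /\ X t w = y]); last first.
  by apply/seteqP; split=> w /= [] // ? ?; split => // -[].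
rewrite (_ : [set w | _ /\ X 0 w = x] = [set w | X 0 w = x]); last first.
  by apply/seteqP; split=> w /= [] // ?; split => // -[].
by apply; case.
Qed.

Lemma start_law_le (B : set T) t x : 0 <= t -> S x ->
  (P [set w | X 0 w = x] * (mass S p B t x)%:E
   <= P [set w | X 0 w = x /\ B (X t w)])%E.
Proof.
move=> t0 Sx.
have m0 z : measurable [set w | X 0 w = z /\ B (X t w)].
  rewrite (_ : [set w | _] = [set w | X 0 w = z] `&` [set w | B (X t w)])//.
  by apply: measurableI; [exact: (event_measurable [set z])|exact: event_measurable].
have Pfin : P [set w | X 0 w = x] = (fine (P [set w | X 0 w = x]))%:E.
  by rewrite fineK// fin_num_measure//; exact: (event_measurable [set x]).
rewrite (mass_esum tf B t0 Sx).1 Pfin.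
apply: (le_trans (le_scale_esum _ _ _)); first exact: fine_ge0.
apply: ge_ereal_sup => _ /= [F [finF FSB] <-].
have mF z : F z -> measurable [set w | X 0 w = x /\ X t w = z].
  move=> _; rewrite (_ : [set w | _] = [set w | X 0 w = x] `&` [set w | X t w = z])//.
  by apply: measurableI; [exact: (event_measurable [set x])|exact: (event_measurable [set z])].
apply: (@le_trans _ _ (P (\bigcup_(z in F) [set w | X 0 w = x /\ X t w = z]))).
  rewrite measure_fin_bigcup//; last first.
    by move=> i j _ _ [w [/= [_ wi] [_ wj]]]; rewrite -wi -wj.
  rewrite !fsbig_finite//= !big_seq; apply: lee_sum => z.
  rewrite in_fset_set// inE => Fz; have [Sz _] := FSB _ Fz.
  by rewrite two_time_law// Pfin EFinM.
apply: le_measure; rewrite ?inE//; first exact: fin_bigcup_measurable.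
by move=> w [z Fz /= [-> ->]]; split => //; have [] := FSB _ Fz.
Qed.

(** Continuity from below along the enumeration of the countable state space. *)
Lemma start_concentrates (eps : R) : 0 < eps -> exists F : set T,
  [/\ finite_set F, F `<=` S & ((1 - eps)%:E < P [set w | F (X 0 w)])%E].
Proof.
move=> eps0; pose F n := S `&` (g @` `I_n).
pose E n := [set w | F n (X 0 w)].
have mE n : measurable (E n) by exact: event_measurable.
have E_T : \bigcup_n E n = setT.
  apply/seteqP; split => // w _; have Sw := mp_state mp w (lexx 0).
  by have [n _ gn] := Sg Sw; exists n.+1 => //; split => //; exists n => //=.
have Emono : nondecreasing_seq E.
  apply/nondecreasing_seqP => n; apply/subsetPset => w [Sw [k /= kn gk]].
  by split=> //; exists k => //=; lia.
have : P (E n) @[n --> \oo] --> 1%E.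
  rewrite -(probability_setT P) -E_T.
  exact: (@nondecreasing_cvg_mu _ _ _ P E mE (bigcupT_measurable _ mE) Emono).
move=> /fine_cvgP[_ /cvgrPdist_lt /(_ _ eps0)] [n _ /(_ n (leqnn n))].
rewrite /= => /ltr_distlDr; rewrite -ltrBlDr => Pn.
exists (F n); split; [|exact: subIsetl|].
  by apply: sub_finite_set (finite_image g (finite_II n)); exact: subIsetr.
have finP : P (E n) \is a fin_num by exact: fin_num_measure.
by rewrite -/(E n) -(fineK finP) lte_fin.
Qed.

(** Finitely many starting points carry the initial law up to eps / 2, so the pointwise
    lower bounds hold from a common time on. *)
Lemma probability_eventually (B : set T) (eps : R) : 0 < eps ->
  (forall x (e : R), S x -> 0 < e ->
    exists t0, forall t, t0 <= t -> 1 - e <= mass S p B t x) ->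
  \forall t \near +oo, ((1 - eps)%:E <= P [set w | B (X t w)])%E.
Proof.
move=> eps0 massB; have e2 : 0 < eps / 2 by rewrite divr_gt0.
have [F [finF FS PF]] := start_concentrates e2.
have mF (x : T) : measurable [set w | X 0 w = x] by exact: (event_measurable [set x]).
have [t1 t1P] : exists t1, forall t, t1 <= t -> forall x, F x -> 1 - eps / 2 <= mass S p B t x.
  have /finite_seqP[s Fs] := finF.
  have : forall x, x \in s -> S x by move=> x xs; apply: FS; rewrite Fs.
  rewrite Fs; elim: s {Fs} => [|x s IH] sS; first by exists 0.
  have [t1 H1] := massB x _ (sS _ (mem_head _ _)) e2.
  have [z zs|t2 H2] := IH; first by apply: sS; rewrite inE zs orbT.
  exists (Num.max t1 t2) => t; rewrite ge_max => /andP[tt1 tt2] z /=.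
  by rewrite inE => /orP[/eqP ->|]; [exact: H1|exact: H2].
near=> t; have t0 : 0 <= t by near: t; exact/nbhs_pinfty_ge/num_real.
have tt1 : t1 <= t by near: t; exact/nbhs_pinfty_ge/num_real.
have mB : measurable [set w | B (X t w)] by exact: event_measurable.
apply: (@le_trans _ _ (\sum_(x \in F) P [set w | X 0 w = x /\ B (X t w)])%E); last first.
  have mFB x : F x -> measurable [set w | X 0 w = x /\ B (X t w)].
    by move=> _; apply: (measurableI [set w | X 0 w = x]).
  rewrite -measure_fin_bigcup//; last first.
    by move=> i j _ _ [w [/= [wi _] [wj _]]]; rewrite -wi -wj.
  apply: le_measure; rewrite ?inE//; first exact: fin_bigcup_measurable.
  by move=> w [x _ []].
apply: (@le_trans _ _ (\sum_(x \in F) (P [set w | X 0 w = x] * (1 - eps / 2)%:E))%E); last first.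
  rewrite !fsbig_finite//= !big_seq; apply: lee_sum => x.
  rewrite in_fset_set// inE => Fx; apply: le_trans (start_law_le B t0 (FS _ Fx)).
  by rewrite lee_wpmul2l// lee_fin; exact: t1P.
have -> : (\sum_(x \in F) (P [set w | X 0 w = x] * (1 - eps / 2)%:E) =
    P [set w | F (X 0 w)] * (1 - eps / 2)%:E)%E.
  rewrite (_ : [set w | F (X 0 w)] = \bigcup_(x in F) [set w | X 0 w = x]); last first.
    by apply/seteqP; split=> [w Fw|w [x Fx /= ->]//]; exists (X 0 w).
  rewrite measure_fin_bigcup//; last first.
    by move=> i j _ _ [w [/= wi wj]]; rewrite -wi -wj.
  by rewrite !fsbig_finite//= ge0_sume_distrl.
have P1 : (P [set w | F (X 0%R w)] <= 1)%E by exact/probability_le1/event_measurable.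
move: PF P1; rewrite -[P [set w | F (X 0 w)]]fineK ?fin_num_measure//; last first.
  exact: event_measurable.
by rewrite -EFinM !lee_fin lte_fin; nra.
Unshelve. all: by end_near. Qed.
End Process.

(** * The leftmost particle escapes to minus infinity *)

Lemma alpha_partial_sums_unbounded {R : realType} (a b : nat -> R) :
  (forall k, 0 < a k) -> (forall k, 0 < b k) ->
  (\sum_(0 <= k <oo) (alpha a b k)%:E = +oo)%E ->
  forall C : R, exists n, C < \sum_(k < n) alpha a b k.
Proof.
move=> a0 b0 halpha C; apply: contrapT => /forallNP bounded.
have : (\sum_(0 <= k <oo) (alpha a b k)%:E <= C%:E)%E.
  apply: lime_le.
    by apply: is_cvg_nneseries => n _ _; rewrite lee_fin divr_ge0// ltW// prodr_gt0.
  apply: nearW => n; rewrite big_mkord sumEFin lee_fin leNgt; apply/negP.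
  exact: bounded.
by rewrite halpha leye_eq.
Qed.

Theorem corollary1p16 (R : realType) (a b : nat -> R)
    (d : measure_display) (Omega : measurableType d) (P : probability Omega R)
    (X : R -> Omega -> nat -> int)
    (ha : forall k, 0 < a k) (hb : forall k, 0 < b k)
    (ha_bounded : has_ubound (range a)) (hb_bounded : has_ubound (range b))
    (hV : admissible a b !=set0)
    (halpha : (\sum_(0 <= k <oo) (alpha a b k)%:E = +oo)%E)
    (hX0 : forall w, finite_configuration (X 0 w))
    (hX : exclusion_process a b P X) :
  forall M : R, 0 <= M ->
    P [set w | (X t w 0%N)%:~R < - M] @[t --> +oo] --> 1%E.
Proof.
move=> M _; have [p [tf hr mp]] := hX.
have [A Aub] := ha_bounded; have a_le k : a k <= A by apply: Aub; exists k.
have [g Sg] := finite_configuration_enum.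
pose B := [set z : nat -> int | (z 0%N)%:~R < - M].
have low (eps : R) : 0 < eps ->
    \forall t \near +oo, ((1 - eps)%:E <= P [set w | B (X t w)])%E.
  move=> eps0; apply: (probability_eventually tf mp Sg) => // x e Sx e0.
  apply: (leftmost_escapes ha hb a_le tf hr) => //.
  exact: alpha_partial_sums_unbounded.
apply/fine_cvgP; split.
  near=> t; apply: fin_num_measure.
  by apply: (event_measurable mp Sg B); near: t; exact/nbhs_pinfty_ge/num_real.
apply/cvgrPdist_le => eps eps0; near=> t.
have mB : measurable [set w | B (X t w)].
  by apply: (event_measurable mp Sg B); near: t; exact/nbhs_pinfty_ge/num_real.
have : ((1 - eps)%:E <= P [set w | B (X t w)])%E by near: t; exact: low.
have := probability_le1 P mB.
rewrite /= -/(B _) -[P [set w | B (X t w)]]fineK ?fin_num_measure// !lee_fin => P1 Pe.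
by rewrite ger0_norm ?subr_ge0// lerBlDl -lerBlDr.
Unshelve. all: by end_near. Qed.
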